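(* Let $a>0$ and $b\in\mathbb{C}$ with $\mathrm{Re}(b)>0$, let $\phi$ be the self-map of $\mathbb{C}_+$ defined by $\phi(w)=aw+b$, and let $C_\phi$ be the composition operator $C_\phi f=f\circ\phi$ on $H^2(\mathbb{C}_+)$. (a) If $a\in(0,1)$ and $\mathrm{Re}(b)>0$, then $C_\phi$ is not cohyponormal on $H^2(\mathbb{C}_+)$. (b) If $a\in(1,\infty)$ and $\mathrm{Re}(b)>0$, then $C_\phi$ is cohyponormal on $H^2(\mathbb{C}_+)$.
   Context: $\mathbb{C}_+=\{z\in\mathbb{C}:\mathrm{Re}(z)>0\}$. $H^2(\mathbb{C}_+)$ is the Hilbert space of analytic functions $f$ on $\mathbb{C}_+$ with $\|f\|=\left(\sup_{0<x<\infty}\frac{1}{\pi}\int_{-\infty}^{\infty}|f(x+iy)|^2\,dy\right)^{1/2}<\infty$. For $a>0$ and $\mathrm{Re}(b)\ge 0$ the map $\phi(w)=aw+b$ induces a bounded composition operator on $H^2(\mathbb{C}_+)$. A bounded operator $T$ on a Hilbert space $\mathcal{H}$ is cohyponormal if $\|Tx\|\le\|T^*x\|$ for all $x\in\mathcal{H}$. *)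

(* Defs.v *)
From HB Require Import structures.
From mathcomp Require Import all_boot all_order all_algebra.
From mathcomp Require Import all_classical all_reals all_analysis measurable_realfun.
From mathcomp Require Import complex.
Set Implicit Arguments.
Unset Strict Implicit.
Unset Printing Implicit Defensive.
Import Order.TTheory GRing.Theory Num.Theory numFieldNormedType.Exports.
(* Not the [R[i]]-valued [Num.Re] and [Num.Im]. *)
Local Notation Re := complex.Re.
Local Notation Im := complex.Im.
Local Notation normc := ComplexField.Normc.normc.
Local Open Scope classical_set_scope.
Local Open Scope ring_scope.
Local Open Scope complex_scope.

Definition Cplus (R : realType) : set R[i] := [set z | 0 < Re z].

(* [R[i]^o] is [R[i]] as a normed space over itself, so [derivable _ z 1] is
   complex differentiability at [z]. *)
Definition analytic_on (R : realType) (D : set R[i]) (f : R[i] -> R[i]) :=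
  forall z, D z -> derivable (f : R[i]^o -> R[i]^o) z 1.

(* The mean of [|f|^2] over the vertical line [Re z = x]. *)
Definition line_mean (R : realType) (f : R[i] -> R[i]) (x : R) : \bar R :=
  ((pi^-1)%:E * \int[lebesgue_measure]_y (normc (f (x +i* y)) ^+ 2)%:E)%E.

Definition hardy_sup (R : realType) (f : R[i] -> R[i]) : \bar R :=
  ereal_sup [set line_mean f x | x in [set x | 0 < x]].

Definition hardy_norm (R : realType) (f : R[i] -> R[i]) : R :=
  Num.sqrt (fine (hardy_sup f)).

(* Functions on [Cplus] are encoded as functions on [R[i]] vanishing outside
   [Cplus], so that equality is equality on [Cplus]. *)
Definition hardy (R : realType) : set (R[i] -> R[i]) :=
  [set f | [/\ analytic_on (@Cplus R) f, (hardy_sup f < +oo)%E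
             & forall z, ~ Cplus z -> f z = 0]].

Definition H2 (R : realType) : Type := set_type (@hardy R).
Definition H2_fun (R : realType) (f : H2 R) : R[i] -> R[i] := val f.
Coercion H2_fun : H2 >-> Funclass.

Definition toH2 (R : realType) (f : R[i] -> R[i]) (hf : hardy f) : H2 R :=
  exist _ f (mem_set hf).

(* The inner product of the Hilbert space [H2], linear in the first argument,
   recovered from the norm by polarization. *)
Definition hardy_dot (R : realType) (f g : R[i] -> R[i]) : R[i] :=
  4^-1 * \sum_(k < 4) 'i%C ^+ k *
           (hardy_norm (fun z => f z + 'i%C ^+ k * g z) ^+ 2)%:C.

(* Linearity is stated pointwise: [h = c f + g] in [H2] implies
   [T h = c T f + T g]. *)
Record bounded_operator (R : realType) := BoundedOperator {
  operator_fun :> H2 R -> H2 R ;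
  _ : forall (c : R[i]) (f g h : H2 R),
        (forall z, h z = c * f z + g z) ->
        forall z, operator_fun h z = c * operator_fun f z + operator_fun g z ;
  _ : exists M : R, forall f : H2 R,
        hardy_norm (operator_fun f) <= M * hardy_norm f
}.

Lemma hardy0 (R : realType) : hardy (fun _ : R[i] => 0).
Proof.
split => //.
apply: (@le_lt_trans _ _ 0%E); last exact: ltry.
apply: ge_ereal_sup => _ [x _ <-]; rewrite /line_mean.
rewrite integral0_eq ?mule0// => y _.
by rewrite (eqP (_ : normc (0 : R[i]) == 0)) ?expr0n//= expr0n/= addr0 sqrtr0.
Qed.

HB.instance Definition _ (R : realType) :=
  Choice.copy (H2 R) (set_type (@hardy R)).
HB.instance Definition _ (R : realType) :=
  isPointed.Build (H2 R) (toH2 (@hardy0 R)).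

(* By the Riesz theorem the adjoint exists and is unique, so the default value
   of [get] is never used. *)
Definition adjoint (R : realType) (T : bounded_operator R) : H2 R -> H2 R :=
  get [set S : H2 R -> H2 R |
        forall f g : H2 R, hardy_dot (T f) g = hardy_dot f (S g)].

Definition cohyponormal (R : realType) (T : bounded_operator R) :=
  forall f : H2 R, hardy_norm (T f) <= hardy_norm (adjoint T f).

(* [f \o phi] on [Cplus], extended by [0]. *)
Definition comp_fun (R : realType) (phi f : R[i] -> R[i]) : R[i] -> R[i] :=
  fun z => if 0 < Re z then f (phi z) else 0.

Definition bounded_composition (R : realType) (phi : R[i] -> R[i]) :=
  [/\ forall z, Cplus z -> Cplus (phi z),
      forall f : H2 R, hardy (comp_fun phi f)
    & exists M : R, forall f : H2 R,
        hardy_norm (comp_fun phi f) <= M * hardy_norm f].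

Section composition_operator.
Context (R : realType) (phi : R[i] -> R[i]) (hphi : bounded_composition phi).

Lemma comp_hardy (f : H2 R) : hardy (comp_fun phi f).
Proof. by case: hphi. Qed.

Let comp_linear (c : R[i]) (f g h : H2 R) :
  (forall z, h z = c * f z + g z) ->
  forall z, toH2 (comp_hardy h) z =
            c * toH2 (comp_hardy f) z + toH2 (comp_hardy g) z.
Proof.
move=> hfg z; rewrite /H2_fun/= /comp_fun.
by case: ifP => _; [exact: hfg|rewrite mulr0 addr0].
Qed.

Let comp_bounded : exists M : R, forall f : H2 R,
  hardy_norm (toH2 (comp_hardy f)) <= M * hardy_norm f.
Proof. by case: hphi. Qed.

Definition composition_operator : bounded_operator R :=
  BoundedOperator comp_linear comp_bounded.

Lemma composition_operatorE (f : H2 R) z : Cplus z ->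
  composition_operator f z = f (phi z).
Proof. by rewrite /H2_fun/= /comp_fun /Cplus/= => ->. Qed.

End composition_operator.
Arguments composition_operator {R} phi hphi.

Definition affine (R : realType) (a : R) (b : R[i]) : R[i] -> R[i] :=
  fun w => a%:C * w + b.

Section affine.
Context (R : realType) (a : R) (b : R[i]) (a0 : 0 < a) (b0 : 0 <= Re b).

Let affineE x y : affine a b (x +i* y) = (a * x + Re b) +i* (a * y + Im b).
Proof. by rewrite /affine; case: b => u v /=; simpc. Qed.

Let affine_Cplus z : Cplus z -> Cplus (affine a b z).
Proof.
by case: z => x y; rewrite affineE /Cplus/= => x0; rewrite ltr_wpDr// mulr_gt0.
Qed.

Let continuous_line (f : R[i] -> R[i]) (x : R) : 0 < x ->
  analytic_on (@Cplus R) f ->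
  continuous (fun y : R => normc (f (x +i* y)) ^+ 2).
Proof.
move=> x0 fan y.
have fc : {for (x +i* y), continuous (f : R[i]^o -> R[i]^o)}.
  apply: differentiable_continuous; apply/derivable1_diffP; exact: fan.
apply: (@continuous_comp _ _ _ (fun y => normc (f (x +i* y))) (fun r => r ^+ 2)).
  apply/cvgrPdist_lt => e e0.
  move/cvgrPdist_lt : fc => /(_ e%:C); rewrite ltcR => /(_ e0).
  move=> /nbhs_normP[d /= d0 H].
  have dRe : d = (Re d)%:C by rewrite RRe_real// gtr0_real.
  have : 0 < Re d by rewrite -ltcR -dRe.
  move=> d0'.
  near=> t.
  have /H/= : ball_ Num.norm (x +i* y) d (x +i* t).
    rewrite /ball_/= dRe.
    have -> : (x +i* y) - (x +i* t) = 0 +i* (y - t) by rewrite /GRing.opp/= /GRing.add/= subrr.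
    rewrite normc_def/= expr0n/= add0r sqrtr_sqr ltcR.
    near: t; apply: (@cvgr_dist_lt _ R^o) => //; exact: cvg_id.
  rewrite normc_def ltcR => H1.
  apply: le_lt_trans H1.
  have -> (z : R[i]) : Num.sqrt (Re z ^+ 2 + Im z ^+ 2) = normc z by case: z.
  have nD := @le_normcD R.
  rewrite ler_norml; apply/andP; split.
    rewrite lerNl opprB lerBlDr.
    rewrite -(normcN (f (x +i* y) - _)) opprB.
    by rewrite (le_trans _ (nD _ _))// subrK.
  by rewrite lerBlDr (le_trans _ (nD _ _))// subrK.
exact: exprn_continuous.
Unshelve. all: by end_near. Qed.

Let line_mean_comp (f : H2 R) x : 0 < x ->
  line_mean (comp_fun (affine a b) f) x =
  ((a^-1)%:E * line_mean f (a * x + Re b))%E.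
Proof.
move=> x0; have [fan _ _] := set_valP f.
have X0 : 0 < a * x + Re b by rewrite ltr_wpDr// mulr_gt0.
rewrite /line_mean muleCA; congr (_ * _)%E.
have D1 (y : R) : is_derive y 1 (fun y => a * y + Im b) a.
  by apply: is_derive_eq; rewrite /GRing.scale/= ?mulr1 ?mulr0 ?addr0 ?add0r.
have D : (fun y : R => a * y + Im b)^`()%classic = cst a.
  by apply/funext => y; rewrite derive1E derive_val.
rewrite [X in _ = (_ * X)%E](increasing_ge0_integration_by_substitutionT
  (F := fun y => a * y + Im b)).
- rewrite D.
  rewrite -ge0_integralZl_EFin//.
  + apply: eq_integral => y _.
    rewrite /comp_fun/= x0 affineE -EFinM; congr EFin.
    rewrite (_ : ((_ : R -> R) * _) y = normc (f ((a * x + Re b) +i* (a * y + Im b))) ^+ 2 * a)//.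
    by rewrite [_ ^+ 2 * a]mulrC mulrA mulVf ?mul1r// gt_eqF.
  + by move=> y _; rewrite lee_fin mulr_ge0// ?sqr_ge0// ltW.
  + apply/measurable_EFinP; apply: continuous_measurable_fun => y.
    apply: cvgM; last exact: cvg_cst.
    apply: (@continuous_comp _ _ _ (fun y => a * y + Im b)
      (fun y => normc (f ((a * x + Re b) +i* y)) ^+ 2)).
      apply/differentiable_continuous/derivable1_diffP.
      exact: (@ex_derive _ _ _ _ _ _ _ (D1 y)).
    exact: continuous_line.
  + by rewrite invr_ge0 ltW.
- by move=> y z yz; rewrite ltrD2r ltr_pM2l.
- by rewrite D; exact: cst_continuous.
- by rewrite D; exact: is_cvg_cst.
- by rewrite D; exact: is_cvg_cst.
- by move=> y; exact: (@ex_derive _ _ _ _ _ _ _ (D1 y)).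
- apply/cvgrNyPle => A; near=> y.
  rewrite -lerBrDr -ler_pdivlMl//; near: y; exact: nbhs_ninfty_le.
- apply/cvgryPge => A; near=> y.
  rewrite -lerBlDr -ler_pdivrMl//; near: y; exact: nbhs_pinfty_ge.
- exact: continuous_line.
- by move=> y; exact: sqr_ge0.
Unshelve. all: by end_near. Qed.

Let hardy_sup_comp (f : H2 R) :
  (hardy_sup (comp_fun (affine a b) f) <= (a^-1)%:E * hardy_sup f)%E.
Proof.
apply: ge_ereal_sup => _ [x /= x0 <-]; rewrite line_mean_comp//.
rewrite lee_pmul2l ?ltry ?lte_fin ?invr_gt0//.
apply: ereal_sup_ubound; exists (a * x + Re b) => //=.
by rewrite ltr_wpDr// mulr_gt0.
Qed.

Let hardy_sup_ge0 (f : R[i] -> R[i]) : (0 <= hardy_sup f)%E.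
Proof.
apply: (@le_trans _ _ (line_mean f 1)).
  apply: mule_ge0; first by rewrite lee_fin invr_ge0 pi_ge0.
  by apply: integral_ge0 => y _; rewrite lee_fin sqr_ge0.
by apply: ereal_sup_ubound; exists 1 => //=.
Qed.

Lemma hardy_affine (f : H2 R) : hardy (comp_fun (affine a b) f).
Proof.
have [fan flt _] := set_valP f; split.
- move=> z zC.
  apply: (@near_eq_derivable _ R[i]^o R[i]^o ((f : R[i]^o -> R[i]^o) \o affine a b)).
    have nC : \forall w \near (z : R[i]^o), 0 < Re w.
      apply/(@nbhs_normP _ R[i]^o); exists (Re z)%:C; first by rewrite /= ltcR; exact: zC.
      move=> w; rewrite /ball_/= => zw.
      have := normc_ge_Re (z - w).
      move=> /le_lt_trans/(_ zw); rewrite ltcR.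
      rewrite ltr_norml raddfB /= => /andP[_].
      by rewrite ltrBlDr ltrDl.
    by apply: filterS nC => w w0; rewrite /comp_fun w0.
  apply/derivable1_diffP/differentiable_comp.
    apply/derivable1_diffP.
    apply: derivableD; last exact: derivable_cst.
    apply: derivableM; first exact: derivable_cst.
    exact: derivable_id.
  by apply/derivable1_diffP; apply: fan; exact: affine_Cplus.
- apply: le_lt_trans (hardy_sup_comp f) _.
  move: (hardy_sup_ge0 f) flt; case: (hardy_sup f) => [r _ _| |]//.
  by rewrite -EFinM ltry.
- by move=> z; rewrite /comp_fun /Cplus/=; case: ifP.
Qed.

Lemma hardy_norm_affine (f : H2 R) :
  hardy_norm (comp_fun (affine a b) f) <= Num.sqrt a^-1 * hardy_norm f.
Proof.
have [_ flt _] := set_valP f; have [_ glt _] := hardy_affine f.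
have H := hardy_sup_comp f.
rewrite /hardy_norm -sqrtrM ?invr_ge0 ?(ltW a0)//; apply: ler_wsqrtr.
move: flt glt H (hardy_sup_ge0 f) (hardy_sup_ge0 (comp_fun (affine a b) f)).
case: (hardy_sup f) => [r| |]//; case: (hardy_sup _) => [s| |]//.
Qed.

Lemma affine_bounded_composition : bounded_composition (affine a b).
Proof.
split; [exact: affine_Cplus|exact: hardy_affine|].
by exists (Num.sqrt a^-1) => f; exact: hardy_norm_affine.
Qed.

End affine.

(* Main.v *)
Require Import Defs.
From mathcomp Require Import all_boot all_order all_algebra.
From mathcomp Require Import all_classical all_reals all_analysis.
From mathcomp Require Import measurable_realfun.
From mathcomp Require Import complex ring lra.
Set Implicit Arguments.
Unset Strict Implicit.
Unset Printing Implicit Defensive.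
Import Order.TTheory GRing.Theory Num.Theory numFieldNormedType.Exports.
Local Open Scope classical_set_scope.
Local Open Scope ring_scope.
Local Open Scope complex_scope.
Local Notation normc := ComplexField.Normc.normc.
Local Notation mu := lebesgue_measure.

(** Write [M f x] for the integral of [|f|^2] over the line [Re z = x]. The
    adjoint of [C_phi] is [g |-> (z |-> a^-1 g ((z + conj b) / a))], so that the squared
    norms of [C_phi f] and of its image under the adjoint are, up to the same
    factor [1 / (a pi)], the suprema of [M f] over [x > Re b] and over
    [x > Re b / a]. For [a > 1] the second range is the larger one; for [a < 1]
    the function [1 / (z + 1)], for which [M f x = pi / (x + 1)], decreases
    strictly between the two.

    The formula for the adjoint rests on contour shifting: the integral over [y]
    of [f (x1 + i y) conj (g (x2 + i y))] depends only on [x1 + x2], because it is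
    the integral of the analytic function [z |-> f z conj (g (s - conj z))] over
    the line [Re z = x1], where [s = x1 + x2]. Applied to [f = g] it also makes [M f]
    midpoint convex; being bounded, [M f] is then nonincreasing, so the supremum
    in the norm is a limit as [x] tends to [0], and the inner product defined by
    polarization is the limit of the inner products over vertical lines. *)

(** * Cauchy's theorem for rectangles *)

Section rectangles.
Context {R : realType}.
Implicit Types (a b w h : R).

(** Every left endpoint lies below every right endpoint, so the supremum of the left endpoints is a
    common point of the intervals. *)
Lemma nested_intervals (u : nat -> R) (l : nat -> R) :
  (forall n, u n <= u n.+1) -> (forall n, u n.+1 + l n.+1 <= u n + l n) ->
  (forall n, 0 <= l n) ->
  exists x, forall n, u n <= x <= u n + l n.
Proof.
move=> u1 ul1 l0.
have um n m : (n <= m)%N -> u n <= u m.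
  by apply: (@homo_leq _ u (fun a b => a <= b)) => // ? ? ?; exact: le_trans.
have ulm n m : (n <= m)%N -> u m + l m <= u n + l n.
  apply: (@homo_leq _ (fun n => u n + l n) (fun a b => b <= a)) => // a b c ab.
  by move=> /le_trans; apply.
have uul n m : u n <= u m + l m.
  apply: (le_trans (um _ (maxn n m) (leq_maxl _ _))).
  apply: (le_trans _ (ulm _ _ (leq_maxr n m))).
  by rewrite lerDl.
exists (sup (range u)) => n; apply/andP; split.
  apply: ub_le_sup; last by exists n.
  by exists (u 0 + l 0) => _ [m _ <-].
by apply: ge_sup => [|_ [m _ <-]]; [exists (u 0), 0|].
Qed.

(** Bisection principle. [G n x y] speaks of the rectangle with lower left corner [(x, y)] and sides
    [w / 2 ^+ n] and [h / 2 ^+ n]. A failing rectangle has a failing quarter; iterating gives nested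
    failing rectangles around a common point, which contradicts the local hypothesis at that
    point. *)
Lemma rectangle_induction (G : nat -> R -> R -> Prop) w h :
  0 <= w -> 0 <= h ->
  (forall n x y, G n.+1 x y -> G n.+1 (x + w / 2 ^+ n.+1) y ->
     G n.+1 x (y + h / 2 ^+ n.+1) ->
     G n.+1 (x + w / 2 ^+ n.+1) (y + h / 2 ^+ n.+1) -> G n x y) ->
  (forall x y, exists N, forall u v,
     u <= x <= u + w / 2 ^+ N -> v <= y <= v + h / 2 ^+ N -> G N u v) ->
  forall x y, G 0 x y.
Proof.
move=> w0 h0 GS Gloc x y; apply: contrapT => nG0.
(* The failure of [G] is a premise under the existential, so that the statement is total in [np] and
   [choice] applies; where [G] holds, the value of [q] is arbitrary. *)
have step (np : nat * (R * R)) : exists q : R * R, ~ G np.1 np.2.1 np.2.2 ->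
    [/\ ~ G np.1.+1 q.1 q.2,
     q.1 = np.2.1 \/ q.1 = np.2.1 + w / 2 ^+ np.1.+1 &
     q.2 = np.2.2 \/ q.2 = np.2.2 + h / 2 ^+ np.1.+1].
  case: np => n [u v] /=.
  have [g|ng] := pselect (G n u v); first by exists (u, v).
  apply: contrapT => H; apply: ng; apply: GS.
  - by apply: contrapT => ng; apply: H; exists (u, v) => _; split; auto.
  - by apply: contrapT => ng; apply: H; exists (u + w / 2 ^+ n.+1, v) => _; split; auto.
  - by apply: contrapT => ng; apply: H; exists (u, v + h / 2 ^+ n.+1) => _; split; auto.
  - apply: contrapT => ng; apply: H.
    by exists (u + w / 2 ^+ n.+1, v + h / 2 ^+ n.+1) => _; split; auto.
have [F FP] := choice step.
pose s := fix s n := if n is m.+1 then F (m, s m) else (x, y).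
have nG n : ~ G n (s n).1 (s n).2.
  by elim: n => // n IH; have [] := FP (n, s n) IH.
have s1 n : (s n.+1).1 = (s n).1 \/ (s n.+1).1 = (s n).1 + w / 2 ^+ n.+1.
  by have [] := FP (n, s n) (nG n).
have s2 n : (s n.+1).2 = (s n).2 \/ (s n.+1).2 = (s n).2 + h / 2 ^+ n.+1.
  by have [] := FP (n, s n) (nG n).
have half (c : R) n : c / 2 ^+ n = c / 2 ^+ n.+1 + c / 2 ^+ n.+1.
  by rewrite exprS; field.
have pos (c : R) n : 0 <= c -> 0 <= c / 2 ^+ n.
  by move=> c0; rewrite divr_ge0// exprn_ge0.
have conv (u : nat -> R) c : 0 <= c ->
    (forall n, u n.+1 = u n \/ u n.+1 = u n + c / 2 ^+ n.+1) ->
    exists X, forall n, u n <= X <= u n + c / 2 ^+ n.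
  move=> c0 us; apply: nested_intervals => n.
  - by case: (us n) => ->//; rewrite lerDl pos.
  - rewrite (half c n); have := pos c n.+1 c0.
    by case: (us n) => ->; lra.
  - exact: pos.
have [X HX] := conv _ _ w0 s1; have [Y HY] := conv _ _ h0 s2.
have [N GN] := Gloc X Y.
by apply: (nG N); exact: GN.
Qed.

Lemma segment_integrable (f : R -> R) a b :
  (forall t, a <= t <= b -> {for t, continuous f}) ->
  mu.-integrable `[a, b] (EFin \o f).
Proof.
move=> cf; apply: continuous_compact_integrable; first exact: segment_compact.
by apply: continuous_in_subspaceT => t; rewrite inE/= in_itv/=; exact: cf.
Qed.

Lemma Rintegral_segmentD (f : R -> R) a b c : a <= b -> b <= c ->
  (forall t, a <= t <= c -> {for t, continuous f}) ->
  \int[mu]_(t in `[a, c]) f t =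
  \int[mu]_(t in `[a, b]) f t + \int[mu]_(t in `[b, c]) f t.
Proof.
move=> ab bc cf.
have := @Rintegral_itvB R f (BLeft a) (BRight c) b (segment_integrable cf).
rewrite !bnd_simp => /(_ ab bc) /eqP; rewrite subr_eq addrC => /eqP ->.
congr (_ + _); apply: Rintegral_itv_obnd_cbnd.
apply: integrableS (segment_integrable cf) => //.
by apply: subset_itv; rewrite bnd_simp.
Qed.

Lemma Rintegral_near_cst (f : R -> R) a b c e : a <= b ->
  (forall t, a <= t <= b -> {for t, continuous f}) ->
  (forall t, a <= t <= b -> `|f t - c| <= e) ->
  `|\int[mu]_(t in `[a, b]) f t - c * (b - a)| <= e * (b - a).
Proof.
move=> ab cf fc.
have cstE (r : R) : \int[mu]_(t in `[a, b]) r = r * (b - a).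
  rewrite Rintegral_cst//= lebesgue_measure_itv/= lte_fin.
  move: ab; rewrite le_eqVlt => /predU1P[<-|ab]; last by rewrite ab.
  by rewrite ltxx subrr.
have cfc t : a <= t <= b -> {for t, continuous (fun t => f t - c)}.
  by move=> /cf ?; apply: cvgB => //; exact: cvg_cst.
rewrite -cstE -RintegralB//; last 2 first.
- exact: segment_integrable.
- by apply: segment_integrable => t _; exact: cvg_cst.
have intfc : mu.-integrable `[a, b] (EFin \o (fun t => f t - c)).
  exact: segment_integrable.
apply: (le_trans (le_normr_Rintegral _ intfc)) => //.
rewrite -cstE; apply: le_Rintegral => //.
- apply: segment_integrable => t /cfc; exact: cvg_norm.
- by apply: segment_integrable => t _; exact: cvg_cst.
Qed.

(** This is total differentiability at [(x, y)] with gradient [(p, q)], with increments measured in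
    the l1 norm. *)
Definition has_partials (P : R -> R -> R) (x y p q : R) :=
  forall e, 0 < e -> exists2 d, 0 < d & forall u v, `|u - x| < d -> `|v - y| < d ->
    `|P u v - P x y - p * (u - x) - q * (v - y)| <= e * (`|u - x| + `|v - y|).

Lemma has_partialsC (P : R -> R -> R) x y p q :
  has_partials P x y p q -> has_partials (fun y x => P x y) y x q p.
Proof.
move=> H e /H[d d0 {}H]; exists d => // v u vy ux.
by have := H _ _ ux vy; rewrite [`|u - x| + _]addrC; congr (`|_| <= _); ring.
Qed.

Lemma has_partials_continuous (P : R -> R -> R) x y p q :
  has_partials P x y p q -> {for x, continuous (P ^~ y)}.
Proof.
move=> H; have [d d0 {}H] := H 1 ltr01.
apply/cvgrPdist_le => e e0; near=> u.
have ux : `|u - x| < d.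
  by rewrite distrC; near: u; apply: (@cvgr_dist_lt _ R^o) => //; exact: cvg_id.
have ux2 : `|u - x| <= e / (1 + `|p|).
  rewrite distrC; near: u; apply: (@cvgr_dist_le _ R^o); first exact: cvg_id.
  by rewrite divr_gt0// ltr_pwDl.
have := H u y ux; rewrite subrr normr0 => /(_ d0).
rewrite mulr0 subr0 addr0 mul1r => Hu.
rewrite distrC -(subrK (p * (u - x)) (_ - _)).
apply: (le_trans (ler_normD _ _)); rewrite normrM.
have : `|u - x| * (1 + `|p|) <= e by rewrite -ler_pdivlMr// ltr_pwDl.
by nra.
Unshelve. all: by end_near. Qed.

Section circulation.
Variables P Q : R -> R -> R.

(** The integral of the form [P dx + Q dy] along the boundary of a rectangle, counterclockwise from
    the corner [(x, y)]. In [closed_form] below, the shared value [q] expresses the equality of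
    [P_y] and [Q_x]. *)
Definition circulation x y w h :=
  \int[mu]_(t in `[x, x + w]) P t y - \int[mu]_(t in `[x, x + w]) P t (y + h) +
  (\int[mu]_(t in `[y, y + h]) Q (x + w) t - \int[mu]_(t in `[y, y + h]) Q x t).

Variables x0 x1 y0 y1 : R.
Hypothesis closed_form : forall x y, x0 <= x <= x1 -> y0 <= y <= y1 ->
  exists p q r, has_partials P x y p q /\ has_partials Q x y q r.

Let cP x y : x0 <= x <= x1 -> y0 <= y <= y1 -> {for x, continuous (P ^~ y)}.
Proof.
by move=> hx hy; have [p [q [r [+ _]]]] := closed_form hx hy; exact: has_partials_continuous.
Qed.

Let cQ x y : x0 <= x <= x1 -> y0 <= y <= y1 -> {for y, continuous (Q x)}.
Proof.
move=> hx hy; have [p [q [r [_]]]] := closed_form hx hy.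
by move/has_partialsC/has_partials_continuous.
Qed.

(** Each inner edge is traversed twice in opposite directions and cancels. *)
Lemma circulation_split x y w h : 0 <= w -> 0 <= h ->
  x0 <= x -> x + (w + w) <= x1 -> y0 <= y -> y + (h + h) <= y1 ->
  circulation x y (w + w) (h + h) =
    circulation x y w h + circulation (x + w) y w h +
    (circulation x (y + h) w h + circulation (x + w) (y + h) w h).
Proof.
move=> w0 h0 hx0 hx1 hy0 hy1; rewrite /circulation !addrA.
have HP z : y0 <= z <= y1 -> \int[mu]_(t in `[x, x + w + w]) P t z =
    \int[mu]_(t in `[x, x + w]) P t z + \int[mu]_(t in `[(x + w), x + w + w]) P t z.
  by move=> hz; apply: Rintegral_segmentD => [||t ht]; [lra|lra|apply: cP => //; lra].
have HQ z : x0 <= z <= x1 -> \int[mu]_(t in `[y, y + h + h]) Q z t =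
    \int[mu]_(t in `[y, y + h]) Q z t + \int[mu]_(t in `[(y + h), y + h + h]) Q z t.
  by move=> hz; apply: Rintegral_segmentD => [||t ht]; [lra|lra|apply: cQ => //; lra].
by rewrite !HP ?HQ; [ring|lra..].
Qed.

(* Since [P_y = Q_x], the circulation of the first-order parts of [P] and [Q]
   vanishes; only the error terms remain. *)
Lemma circulation_small X Y e : x0 <= X <= x1 -> y0 <= Y <= y1 -> 0 < e ->
  exists2 d, 0 < d & forall x y w h, 0 <= w -> 0 <= h ->
    x0 <= x -> x + w <= x1 -> y0 <= y -> y + h <= y1 ->
    x <= X <= x + w -> y <= Y <= y + h -> w < d -> h < d ->
    `|circulation x y w h| <= e * (w + h) ^+ 2.
Proof.
move=> hX hY e0; have [p [q [r [HP HQ]]]] := closed_form hX hY.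
(* Half of [e], because each integrand below is a difference of two values, each with its own error
   term. *)
have e20 : 0 < e / 2 by lra.
have [d1 d10 {}HP] := HP _ e20; have [d2 d20 {}HQ] := HQ _ e20.
exists (Num.min d1 d2) => [|x y w h w0 h0 hx0 hx1 hy0 hy1 Xx Yy].
  by rewrite lt_min d10.
rewrite !lt_min => /andP[wd1 wd2] /andP[hd1 hd2].
have inx u : x <= u <= x + w -> x0 <= u <= x1.
  by case/andP => xu uw; rewrite (le_trans hx0 xu) (le_trans uw hx1).
have iny v : y <= v <= y + h -> y0 <= v <= y1.
  by case/andP => yv vh; rewrite (le_trans hy0 yv) (le_trans vh hy1).
have xl : x <= x <= x + w by rewrite lexx lerDl.
have xr : x <= x + w <= x + w by rewrite lexx lerDl w0.
have yl : y <= y <= y + h by rewrite lexx lerDl.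
have yr : y <= y + h <= y + h by rewrite lexx lerDl h0.
have near u : x <= u <= x + w -> `|u - X| <= w by move=> ?; rewrite ler_norml; lra.
have neary v : y <= v <= y + h -> `|v - Y| <= h by move=> ?; rewrite ler_norml; lra.
have errP u v : x <= u <= x + w -> y <= v <= y + h ->
    `|P u v - P X Y - p * (u - X) - q * (v - Y)| <= e / 2 * (w + h).
  move=> /near hu /neary hv.
  apply: (le_trans (HP u v (le_lt_trans hu wd1) (le_lt_trans hv hd1))).
  by rewrite ler_pM2l//; exact: lerD.
have errQ u v : x <= u <= x + w -> y <= v <= y + h ->
    `|Q u v - Q X Y - q * (u - X) - r * (v - Y)| <= e / 2 * (w + h).
  move=> /near hu /neary hv.
  apply: (le_trans (HQ u v (le_lt_trans hu wd2) (le_lt_trans hv hd2))).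
  by rewrite ler_pM2l//; exact: lerD.
have iP v : y0 <= v <= y1 -> mu.-integrable `[x, x + w] (EFin \o P ^~ v).
  by move=> hv; apply: segment_integrable => t /inx ht; exact: cP.
have iQ u : x0 <= u <= x1 -> mu.-integrable `[y, y + h] (EFin \o Q u).
  by move=> hv; apply: segment_integrable => t /iny ht; exact: cQ.
rewrite /circulation -!RintegralB//;
  [|by apply: iQ; exact: inx|by apply: iQ; exact: inx|
    by apply: iP; exact: iny|by apply: iP; exact: iny].
(* The main terms [- q h w] and [q w h] of the two pairs of edges cancel, and the errors add up to
   [e (w + h) w + e (w + h) h = e (w + h) ^+ 2]. *)
have HA : `|\int[mu]_(t in `[x, x + w]) (P t y - P t (y + h)) - - (q * h) * (x + w - x)|
    <= e * (w + h) * (x + w - x).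
  apply: Rintegral_near_cst; first by rewrite lerDl.
    by move=> t /inx ht; apply: cvgB; apply: cP => //; exact: iny.
  move=> t ht; have := errP _ _ ht yl; have := errP _ _ ht yr.
  by rewrite !ler_norml; lra.
have HB : `|\int[mu]_(t in `[y, y + h]) (Q (x + w) t - Q x t) - q * w * (y + h - y)|
    <= e * (w + h) * (y + h - y).
  apply: Rintegral_near_cst; first by rewrite lerDl.
    by move=> t /iny ht; apply: cvgB; apply: cQ => //; exact: inx.
  move=> t ht; have := errQ _ _ xl ht; have := errQ _ _ xr ht.
  by rewrite !ler_norml; lra.
move: HA HB; rewrite !ler_norml; nra.
Qed.

(** Goursat's argument. The bound [e (w + h) ^+ 2] is inherited from the quarters, since four
    squares of half the size sum to the original square; by [circulation_small] it holds for small
    rectangles around any point. *)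
Lemma closed_form_circulation0 : x0 <= x1 -> y0 <= y1 ->
  circulation x0 y0 (x1 - x0) (y1 - y0) = 0.
Proof.
move=> x01 y01; set w := x1 - x0; set h := y1 - y0.
have w0 : 0 <= w by rewrite subr_ge0.
have h0 : 0 <= h by rewrite subr_ge0.
have [wE hE] : x1 = x0 + w /\ y1 = y0 + h by rewrite /w /h; lra.
clearbody w h.
have pos (c : R) n : 0 <= c -> 0 <= c / 2 ^+ n.
  by move=> c0; rewrite divr_ge0// exprn_ge0.
have half (c : R) n : c / 2 ^+ n = c / 2 ^+ n.+1 + c / 2 ^+ n.+1.
  by rewrite exprS; field.
suff small e : 0 < e -> `|circulation x0 y0 w h| <= e * (w + h) ^+ 2.
  apply/eqP; rewrite -normr_le0; apply/ler_addgt0Pr => e e0.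
  (* The added 1 keeps the divisor positive when the rectangle degenerates to a point. *)
  have D0 : 0 < 1 + (w + h) ^+ 2 by rewrite ltr_pwDl// sqr_ge0.
  apply: (le_trans (small (e / (1 + (w + h) ^+ 2)) _)); first exact: divr_gt0.
  by rewrite add0r mulrAC ler_pdivrMr// ler_pM2l// lerDr.
move=> e0.
pose G n x y := x0 <= x -> x + w / 2 ^+ n <= x1 -> y0 <= y -> y + h / 2 ^+ n <= y1 ->
  `|circulation x y (w / 2 ^+ n) (h / 2 ^+ n)| <= e * ((w + h) / 2 ^+ n) ^+ 2.
have : G 0 x0 y0; last first.
  by rewrite /G expr0 !divr1; apply; lra.
apply: (rectangle_induction w0 h0) => [n x y|x y].
  rewrite /G !mulrDl !(half _ n).
  move: (pos _ n.+1 w0) (pos _ n.+1 h0); move: (w / 2 ^+ n.+1) (h / 2 ^+ n.+1).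
  move=> a b a0 b0 G1 G2 G3 G4 hx0 hx1 hy0 hy1.
  rewrite circulation_split//.
  have xa : x0 <= x + a by rewrite ler_wpDr.
  have yb : y0 <= y + b by rewrite ler_wpDr.
  rewrite addrA in hx1; rewrite addrA in hy1.
  have xa1 : x + a <= x1 by apply: le_trans hx1; rewrite lerDl.
  have yb1 : y + b <= y1 by apply: le_trans hy1; rewrite lerDl.
  have {}G1 := G1 hx0 xa1 hy0 yb1; have {}G2 := G2 xa hx1 hy0 yb1.
  have {}G3 := G3 hx0 xa1 yb hy1; have {}G4 := G4 xa hx1 yb hy1.
  clear xa yb xa1 yb1 hx0 hx1 hy0 hy1.
  apply: (le_trans (ler_normD _ _)).
  apply: (le_trans (lerD (ler_normD _ _) (ler_normD _ _))).
  by move: G1 G2 G3 G4; lra.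
have [[hx hy]|nxy] := pselect (x0 <= x <= x1 /\ y0 <= y <= y1); last first.
  (* A point outside the large rectangle belongs to no rectangle contained in it, so [G] holds
     vacuously. *)
  exists 0 => u v ux vy ? ? ? ?; exfalso; apply: nxy.
  by lra.
have [d d0 H] := circulation_small hx hy e0.
(* Halving until [(w + h) / 2 ^+ N < d] brings both sides below the radius given by
   [circulation_small]. *)
have : (fun n => (w + h) * 2^-1 ^+ n) @ \oo --> (0 : R).
  rewrite -[X in _ --> X](mulr0 (w + h)); apply: cvgMr; apply: cvg_expr.
  by rewrite ger0_norm; lra.
move/cvgrPdist_lt => /(_ _ d0)[N _ /(_ N (leqnn _))].
rewrite sub0r normrN exprVn => HN.
exists N => u v ux vy hu0 hu1 hv0 hv1.
rewrite mulrDl; apply: H => //; try exact: pos.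
  by apply: le_lt_trans HN; rewrite ger0_norm ?pos ?addr_ge0// mulrDl lerDl pos.
by apply: le_lt_trans HN; rewrite ger0_norm ?pos ?addr_ge0// mulrDl lerDr pos.
Qed.

End circulation.
End rectangles.

(** * Contour shifting in a strip *)

Section strips.
Context {R : realType}.
Implicit Types (x y : R).

(** The sigma-algebra on [R * R] is the product one, so the open set where [F] exceeds [a] is
    exhibited as a countable union of open boxes with rational endpoints. *)
Lemma continuous_measurable_fun2 (F : R * R -> R) :
  continuous F -> measurable_fun [set: R * R] F.
Proof.
move=> cF; apply: (measurability _ (RGenOInfty.measurableE R)) => //.
move=> /= _ [_ [a ->] <-]; rewrite setTI.
pose box (q1 q2 q3 q4 : rat) : set (R * R) :=
  `]ratr q1, ratr q2[%classic `*` `]ratr q3, ratr q4[%classic.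
rewrite [X in measurable X](_ : _ = \bigcup_q1 \bigcup_q2 \bigcup_q3 \bigcup_q4
    (if `[< box q1 q2 q3 q4 `<=` F @^-1` `]a, +oo[ >] then box q1 q2 q3 q4 else set0)).
  do 4 apply: bigcupT_measurable_rat => ?.
  by case: ifP => // _; exact: measurableX.
apply/seteqP; split => [[x y]|p]; last first.
  by move=> [q1 _ [q2 _ [q3 _ [q4 _]]]]; case: ifP => // /asboolP; apply.
rewrite /= in_itv/= andbT => aF.
have : \forall p \near (x, y), a < F p by apply: (cvgr_gt _ (cF (x, y))).
move=> [[A B] /= [[e1 /= e10 A1] [e2 /= e20 B2]] AB].
have nb (z e : R) : 0 < e -> exists q1 q2 : rat,
    [/\ z - e < ratr q1, ratr q1 < z, z < ratr q2 & ratr q2 < z + e].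
  move=> e0; have ze : z - e < z by rewrite ltrBlDr ltrDl.
  have ze' : z < z + e by rewrite ltrDl.
  have [q1] := rat_in_itvoo ze; have [q2] := rat_in_itvoo ze'.
  by rewrite !in_itv/= => /andP[? ?] /andP[? ?]; exists q1, q2.
have [q1 [q2 [h1 h2 h3 h4]]] := nb x e1 e10.
have [q3 [q4 [h5 h6 h7 h8]]] := nb y e2 e20.
exists q1 => //; exists q2 => //; exists q3 => //; exists q4 => //.
rewrite ifT; first by split; rewrite /= in_itv/=; apply/andP; split.
apply/asboolP => -[u v] [/=]; rewrite !in_itv/= andbT => hu hv.
apply: (AB (u, v)); split => /=.
  by apply: A1; rewrite /ball_/= ltr_norml; lra.
by apply: B2; rewrite /ball_/= ltr_norml; lra.
Qed.

(** A function bounded below by [e > 0] on a half-line has infinite integral there, so [h] drops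
    below [e] on both sides of any [A]. *)
Lemma integrable_small_far (h : R -> \bar R) (e A : R) : measurable_fun setT h ->
  (forall t, 0 <= h t)%E -> (\int[mu]_t h t < +oo)%E -> 0 < e ->
  exists S T, [/\ S <= A, A <= T, (h S < e%:E)%E & (h T < e%:E)%E].
Proof.
move=> mh h0 hoo e0.
have far (D : set R) : measurable D -> mu D = +oo%E -> exists2 t, D t & (h t < e%:E)%E.
  move=> mD Doo; apply: contrapT => H.
  have : (+oo <= \int[mu]_t h t)%E; last by rewrite leNgt hoo.
  rewrite (_ : +oo%E = \int[mu]_(t in D) e%:E)%E; last first.
    by rewrite integral_cst//= Doo gt0_muley.
  apply: (@le_trans _ _ (\int[mu]_(t in D) h t)%E).
    apply: ge0_le_integral => //; first by move=> *; rewrite lee_fin ltW.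
      exact: measurable_funTS.
    by move=> t Dt; rewrite leNgt; apply/negP => ht; apply: H; exists t.
  exact: ge0_subset_integral.
have [|S SA hS] := far [set` `]-oo, A]] (measurable_itv _).
  by rewrite lebesgue_measure_itv/= ltNyr.
have [|T TA hT] := far [set` `[A, +oo[] (measurable_itv _).
  by rewrite lebesgue_measure_itv/= ltry.
by exists S, T; split => //; move: SA TA; rewrite /= !in_itv/= ?andbT.
Qed.

Lemma has_partials_continuous2 (P : R -> R -> R) x y p q :
  has_partials P x y p q -> {for (x, y), continuous (fun z => P z.1 z.2)}.
Proof.
move=> H; have [d d0 {}H] := H 1 ltr01.
apply/cvgrPdist_le => e e0.
pose c := e / (1 + `|p| + (1 + `|q|)).
have D0 : 0 < 1 + `|p| + (1 + `|q|) by rewrite addr_gt0// ltr_pwDl.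
have c0 : 0 < c by rewrite divr_gt0.
near=> z.
have u1 : `|z.1 - x| < d.
  by rewrite distrC; near: z; apply: (@cvgr_dist_lt _ R^o) => //; exact: cvg_fst.
have u2 : `|z.1 - x| <= c.
  by rewrite distrC; near: z; apply: (@cvgr_dist_le _ R^o) => //; exact: cvg_fst.
have v1 : `|z.2 - y| < d.
  by rewrite distrC; near: z; apply: (@cvgr_dist_lt _ R^o) => //; exact: cvg_snd.
have v2 : `|z.2 - y| <= c.
  by rewrite distrC; near: z; apply: (@cvgr_dist_le _ R^o) => //; exact: cvg_snd.
have := H _ _ u1 v1; rewrite mul1r /= => Hz.
rewrite distrC -(subrK (p * (z.1 - x)) (_ - _)) -(subrK (q * (z.2 - y)) (_ - _ - _)).
apply: (le_trans (ler_normD _ _)); apply: (le_trans (lerD (ler_normD _ _) (lexx _))).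
rewrite !normrM.
have ec : e = c * (1 + `|p| + (1 + `|q|)) by rewrite /c divfK// gt_eqF.
have pu : `|p| * `|z.1 - x| <= `|p| * c by rewrite ler_wpM2l.
have qv : `|q| * `|z.2 - y| <= `|q| * c by rewrite ler_wpM2l.
by rewrite ec; lra.
Unshelve. all: by end_near. Qed.

(** Dominated convergence with majorant [|f|]. The endpoints are arbitrary beyond [-n] and [n],
    because [horizontal_small] does not control where exactly its heights fall. *)
Lemma cvg_Rintegral_exhaust (f : R -> R) (S T : nat -> R) :
  mu.-integrable setT (EFin \o f) ->
  (forall n, S n <= - n%:R) -> (forall n, n%:R <= T n) ->
  \int[mu]_(t in `[S n, T n]) f t @[n --> \oo] --> \int[mu]_t f t.
Proof.
move=> intf Sn Tn; apply: fine_cvg; rewrite fineK; last exact: integrable_fin_num.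
under eq_fun do rewrite integral_mkcond.
have /integrableP[mf foo] := intf.
have [| | | | |_ _ //] := @dominated_convergence _ _ _ mu setT measurableT
  (fun n => (EFin \o f) \_ `[S n, T n]) (EFin \o f) (abse \o EFin \o f).
- by move=> n; apply/(measurable_restrict _ _ _) => //; rewrite setTI; exact: measurable_funTS.
- exact: mf.
- apply: aeW => t _; apply: cvg_near_cst.
  near=> n; rewrite patchE mem_set// /= in_itv/=.
  have tn : `|t| <= n%:R by near: n; exact: nbhs_infty_ger.
  move: tn; rewrite ler_norml => /andP[tn1 tn2].
  by rewrite (le_trans (Sn n) tn1) (le_trans tn2 (Tn n)).
- exact: integrable_abse.
- by apply: aeW => t n _; rewrite patchE; case: ifP => _ //=; rewrite ?lexx ?normr0 ?lee_fin.
Unshelve. all: by end_near. Qed.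

End strips.

Section strip_shift.
Context {R : realType}.
Variables (P Q : R -> R -> R) (x0 x1 C : R).
Hypothesis x01 : x0 <= x1.
Hypothesis closed_form : forall x y, x0 <= x <= x1 ->
  exists p q r, has_partials P x y p q /\ has_partials Q x y q r.
Hypothesis P_bound : forall x, x0 <= x <= x1 -> (\int[mu]_y `|P x y|%:E <= C%:E)%E.

(* Clamping [x] extends [P] from the strip to a continuous function on the
   plane, hence a measurable one, as needed for Tonelli's theorem. *)
Let clamp x := Num.max x0 (Num.min x x1).

Let clampP x : x0 <= clamp x <= x1.
Proof. by rewrite /clamp le_max lexx/= ge_max x01 ge_min lexx orbT. Qed.

Let clampE x : x0 <= x <= x1 -> clamp x = x.
Proof. by case/andP => h1 h2; rewrite /clamp min_l// max_r. Qed.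

Let clamp_continuous : continuous clamp.
Proof.
move=> x; apply: (@continuous_max _ _ (cst x0) (fun x => Num.min x x1)).
  exact: cvg_cst.
by apply: (@continuous_min _ _ id (cst x1)); [exact: cvg_id|exact: cvg_cst].
Qed.

Let f (z : R * R) : \bar R := `|\1_`[x0, x1] z.1 * P (clamp z.1) z.2|%:E.

Let f0 z : (0 <= f z)%E. Proof. by rewrite lee_fin. Qed.

Let mf : measurable_fun [set: R * R] f.
Proof.
apply/measurable_EFinP; apply: measurableT_comp => //; apply: measurable_funM.
  exact: (@measurableT_comp _ _ _ _ _ _ (\1_`[x0, x1] : R -> R) _ fst).
apply: continuous_measurable_fun2 => -[x y].
have [p [q [_ [HP _]]]] := closed_form y (clampP x).
apply: (continuous2_cvg _ (has_partials_continuous2 HP)); last exact: cvg_snd.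
by apply: (@cvg_comp _ _ _ fst clamp _ (nbhs x) _ _ (@clamp_continuous x)); exact: cvg_fst.
Qed.

(* By Tonelli the integral of [|P|] over the strip is finite. *)
Lemma horizontal_small (e A : R) : 0 < e -> exists S T, [/\ S <= A, A <= T,
  `|\int[mu]_(x in `[x0, x1]) P x S| < e & `|\int[mu]_(x in `[x0, x1]) P x T| < e].
Proof.
move=> e0.
(* [h t] dominates the integral over the horizontal segment at height [t], so it is enough to find
   heights where [h] is small. *)
pose h (t : R) : \bar R := (\int[mu]_x f (x, t))%E.
have h0 t : (0 <= h t)%E by apply: integral_ge0 => x _; rewrite lee_fin.
have mh : measurable_fun setT h.
  exact: (@measurable_fun_fubini_tonelli_G _ _ _ _ _ mu f mf f0).
have hoo : (\int[mu]_t h t < +oo)%E.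
  rewrite /h -fubini_tonelli//.
  apply: (@le_lt_trans _ _ (\int[mu]_(x in `[x0, x1]) C%:E)%E); last first.
    rewrite integral_cst//= lebesgue_measure_itv/=.
    by case: ifP => _; rewrite ?mule0 ?ltry.
  rewrite [leRHS]integral_mkcond; apply: ge0_le_integral => //.
  - by move=> x _; apply: integral_ge0 => y _; rewrite lee_fin.
  - exact: (@measurable_fun_fubini_tonelli_F _ _ _ _ _ mu f mf f0).
  - by apply/(measurable_restrict _ _ _).
  - move=> x _; rewrite patchE /f/= indicE; case: ifPn => xI.
      have hx : x0 <= x <= x1 by move: xI; rewrite inE/= in_itv.
      by under eq_integral do rewrite mul1r clampE//; exact: P_bound.
    by under eq_integral do rewrite mul0r normr0; rewrite integral0.
have [S [T [SA AT hS hT]]] := integrable_small_far A mh h0 hoo e0.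
have bound t : (h t < e%:E)%E -> `|\int[mu]_(x in `[x0, x1]) P x t| < e.
  move=> ht.
  have cP : forall x, x0 <= x <= x1 -> {for x, continuous (P ^~ t)}.
    by move=> x /(closed_form t)[p [q [_ [+ _]]]]; exact: has_partials_continuous.
  rewrite -lte_fin; apply: le_lt_trans ht.
  have iP : mu.-integrable `[x0, x1] (EFin \o P ^~ t) by exact: segment_integrable.
  rewrite EFin_normr_Rintegral//.
  apply: (le_trans (le_abse_integral _ _ _)) => //; first exact: measurable_int iP.
  rewrite integral_mkcond /h; apply: ge0_le_integral => //.
  - by move=> x _; rewrite patchE; case: ifP.
  - apply/(measurable_restrict _ _ _) => //; rewrite setTI.
    exact: measurableT_comp (measurable_int _ iP).
  - by apply: measurableT_comp mf _; exact: measurable_pair2.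
  - move=> x _; rewrite patchE /f/= indicE; case: ifPn => xI; last by rewrite lee_fin.
    have hx : x0 <= x <= x1 by move: xI; rewrite inE/= in_itv.
    by rewrite clampE// mulr1n mul1r.
by exists S, T; split => //; exact: bound.
Qed.

(** The circulation around the rectangle between the heights [S n] and [T n] vanishes. Its
    horizontal edges tend to 0 by the choice of the heights, and its vertical edges tend to the
    integrals over the two full lines. *)
Lemma strip_shift :
  mu.-integrable setT (EFin \o Q x0) -> mu.-integrable setT (EFin \o Q x1) ->
  \int[mu]_y Q x0 y = \int[mu]_y Q x1 y.
Proof.
move=> i0 i1.
have exST n : exists ST : R * R, [/\ ST.1 <= - n%:R, n%:R <= ST.2,
    `|\int[mu]_(x in `[x0, x1]) P x ST.1| < n.+1%:R^-1 &
    `|\int[mu]_(x in `[x0, x1]) P x ST.2| < n.+1%:R^-1].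
  have inv0 : 0 < n.+1%:R^-1 :> R by rewrite invr_gt0.
  (* One application at [-n] supplies the lower height, another at [n] the upper one. *)
  have [S [_ [? _ ? _]]] := horizontal_small (- n%:R) inv0.
  have [_ [T [_ ? _ ?]]] := horizontal_small n%:R inv0.
  by exists (S, T).
have [ST HST] := choice exST.
have Sn n : (ST n).1 <= - n%:R by have [] := HST n.
have Tn n : n%:R <= (ST n).2 by have [] := HST n.
have c0 := cvg_Rintegral_exhaust i0 Sn Tn.
have c1 := cvg_Rintegral_exhaust i1 Sn Tn.
apply/eqP; rewrite -subr_eq0; apply/eqP.
rewrite -(cvg_lim (@Rhausdorff R) (cvgB c0 c1)); apply: cvg_lim => //.
apply/cvgr0Pnorm_le => e e0; have e20 : 0 < e / 2 by rewrite divr_gt0.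
near=> n.
have ST01 : (ST n).1 <= (ST n).2.
  apply: (le_trans (Sn n)); apply: (le_trans _ (Tn n)).
  by apply: (@le_trans _ _ 0); rewrite ?oppr_le0 ler0n.
have := @closed_form_circulation0 _ P Q x0 x1 (ST n).1 (ST n).2
  (fun x y hx _ => closed_form y hx) x01 ST01.
rewrite /circulation !subrKC.
have : n.+1%:R^-1 < e / 2 by near: n; exact: (near_infty_natSinv_lt (PosNum e20)).
have [_ _] := HST n; rewrite !fctE !ltr_norml ler_norml; move: (n.+1%:R^-1) => c.
by lra.
Unshelve. all: by end_near. Qed.
End strip_shift.

(** * Complex derivatives *)

Section complex_derivative.
Context {R : realType}.
Implicit Types (f g : R[i] -> R[i]) (z w l : R[i]) (x y : R).

Lemma normcE z : `|z| = (normc z)%:C.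
Proof. by case: z. Qed.

Lemma sqr_normc z : normc z ^+ 2 = complex.Re z ^+ 2 + complex.Im z ^+ 2.
Proof. by case: z => x y /=; rewrite sqr_sqrtr// addr_ge0 ?sqr_ge0. Qed.

Lemma normc_ge0 z : 0 <= normc z.
Proof. by case: z => x y /=; exact: sqrtr_ge0. Qed.

Lemma normc0 : normc (0 : R[i]) = 0.
Proof. by rewrite /= expr0n addr0 sqrtr0. Qed.

Lemma ler_Re_normc z : `|complex.Re z| <= normc z.
Proof. by rewrite -lecR -normcE; exact: normc_ge_Re. Qed.

Lemma ler_Im_normc z : `|complex.Im z| <= normc z.
Proof.
rewrite -(@ler_pXn2r _ 2)// ?nnegrE ?normc_ge0// sqr_normc real_normK ?num_real//.
by rewrite lerDr sqr_ge0.
Qed.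

Lemma normc_le_ReIm z : normc z <= `|complex.Re z| + `|complex.Im z|.
Proof.
rewrite -(@ler_pXn2r _ 2)// ?nnegrE ?addr_ge0 ?normc_ge0// sqr_normc sqrrD.
by rewrite !real_normK ?num_real// addrAC lerDl mulrn_wge0// mulr_ge0.
Qed.

(** Complex differentiability with real [e] and [d], through the real-valued [normc], since the norm
    on [R[i]] takes its values in [R[i]]. The product form on the right includes the case
    [w = z]. *)
Definition has_cderiv f z l := forall e : R, 0 < e -> exists2 d : R, 0 < d &
  forall w, normc (w - z) < d -> normc (f w - f z - l * (w - z)) <= e * normc (w - z).

Lemma derivable_has_cderiv f z :
  derivable (f : R[i]^o -> R[i]^o) z 1 -> exists l, has_cderiv f z l.
Proof.
move=> /cvg_ex[/= l fl]; exists l => e e0.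
move/cvgrPdist_le : fl => /(_ e%:C); rewrite ltcR => /(_ e0).
move=> /nbhs_normP[/= d d0 H].
have dE : d = (complex.Re d)%:C by rewrite RRe_real// gtr0_real.
exists (complex.Re d); first by rewrite -ltcR -dE.
move=> w wzd; have [->|wz] := eqVneq w z.
  by rewrite !subrr mulr0 subrr normc0 mulr0.
have wz0 : w - z != 0 by rewrite subr_eq0.
have := H (w - z); rewrite /= sub0r normrN normcE dE ltcR => /(_ wzd wz0).
rewrite /GRing.scale/= mulr1 subrK => Hw.
rewrite -lecR rmorphM/= -!normcE.
rewrite (_ : f w - f z - l * (w - z) = - ((l - (w - z)^-1 * (f w - f z)) * (w - z))).
  by rewrite normrN normrM ler_wpM2r.
by rewrite mulrBl mulrAC mulVf// mul1r opprB.
Qed.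

Lemma has_cderiv_derivable f z l :
  has_cderiv f z l -> derivable (f : R[i]^o -> R[i]^o) z 1.
Proof.
move=> H; apply/cvg_ex; exists l; apply/cvgrPdist_le => /= e e0.
have eE : e = (complex.Re e)%:C by rewrite RRe_real// gtr0_real.
have [|d d0 {}H] := H (complex.Re e); first by rewrite -ltcR -eE.
apply/nbhs_normP; exists d%:C; first by rewrite /= ltcR.
move=> w; rewrite /= sub0r normrN normcE ltcR => wd w0.
have := H (z + w); rewrite addrC addKr => /(_ wd).
rewrite -lecR rmorphM/= -!normcE -eE => Hw.
rewrite /GRing.scale/= mulr1 -(ler_pM2r (_ : 0 < `|w|)) ?normr_gt0// -normrM.
rewrite mulrBl mulrAC mulVf// mul1r.
by rewrite distrC [w + z]addrC.
Qed.

(** The Cauchy-Riemann equations, read off from the real and imaginary parts of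
    [l * ((u - x) +i* (v - y))]. *)
Lemma has_cderiv_partials f x y l : has_cderiv f (x +i* y) l ->
  has_partials (fun u v => complex.Re (f (u +i* v))) x y (complex.Re l) (- complex.Im l) /\
  has_partials (fun u v => complex.Im (f (u +i* v))) x y (complex.Im l) (complex.Re l).
Proof.
move=> H.
suff K e : 0 < e -> exists2 d, 0 < d & forall u v, `|u - x| < d -> `|v - y| < d ->
    normc (f (u +i* v) - f (x +i* y) - l * ((u - x) +i* (v - y))) <=
    e * (`|u - x| + `|v - y|).
  split=> e /K[d d0 {}K]; exists d => // u v ux vy; apply: le_trans (K _ _ ux vy).
    apply: le_trans (ler_Re_normc _); rewrite le_eqVlt; apply/orP; left; apply/eqP.
    by congr `|_|; case: l {K H} => ? ?; case: (f _) => ? ?; case: (f _) => ? ? /=; ring.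
  apply: le_trans (ler_Im_normc _); rewrite le_eqVlt; apply/orP; left; apply/eqP.
  by congr `|_|; case: l {K H} => ? ?; case: (f _) => ? ?; case: (f _) => ? ? /=; ring.
move=> e0; have [d d0 {}H] := H e e0.
exists (d / 2) => [|u v ux vy]; first by rewrite divr_gt0.
have := normc_le_ReIm ((u - x) +i* (v - y)); rewrite /complex.Re/= => n1.
apply: le_trans (_ : e * normc ((u - x) +i* (v - y)) <= _); last by rewrite ler_pM2l.
by apply: H; rewrite /GRing.add/= ; apply: le_lt_trans n1 _; lra.
Qed.

(** The reflection and the outer conjugation are both antiholomorphic, so together they preserve
    holomorphy; the derivative is [- l^*]. *)
Lemma derivable_conj_reflection g (s : R) z :
  derivable (g : R[i]^o -> R[i]^o) (s%:C - z^*) 1 ->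
  derivable ((fun z => (g (s%:C - z^*))^*) : R[i]^o -> R[i]^o) z 1.
Proof.
move=> /derivable_has_cderiv[l H]; apply: (@has_cderiv_derivable _ _ (- l^*)).
move=> e /H[d d0 {}H]; exists d => // w wz.
have nc (u : R[i]) : normc u^* = normc u by case: u => ? ? /=; rewrite sqrrN.
have nN (u : R[i]) : normc (- u) = normc u by case: u => ? ? /=; rewrite !sqrrN.
have E : s%:C - w^* - (s%:C - z^*) = - (w - z)^* by rewrite rmorphB /=; ring.
have := H (s%:C - w^*); rewrite E nN nc => /(_ wz).
rewrite -[in X in X -> _]nc; congr (normc _ <= _).
move: (g _) (g _) => {E H wz}[a b] [a' b']; case: w z l => [u v] [u' v'] [p q].
by apply/eqP; rewrite eq_complex/=; apply/andP; split; apply/eqP; ring.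
Qed.
End complex_derivative.

(** * Integrals over vertical lines *)

(** If [M] increased by [D > 0] over a step of length [d], midpoint convexity would force an
    increase of at least [D] over each later step of that length, and [M] would exceed [K]. *)
Lemma midpoint_convex_bounded_nonincreasing (R : realType) (M : R -> R) (K : R) :
  (forall x, 0 < x -> M x <= K) ->
  (forall x d, 0 <= d -> d < x -> 2 * M x <= M (x - d) + M (x + d)) ->
  forall x y, 0 < x -> x <= y -> M y <= M x.
Proof.
move=> MK Mc x y x0 xy; rewrite leNgt; apply/negP => Mxy.
pose d := y - x; pose D := M y - M x.
have d0 : 0 <= d by rewrite subr_ge0.
have D0 : 0 < D by rewrite subr_gt0.
pose p (n : nat) := x + n%:R * d.
have pS n : p n.+1 = p n + d by rewrite /p -natr1 mulrDl mul1r addrA.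
have xp n : x <= p n by rewrite /p lerDl mulr_ge0.
have step n : D <= M (p n.+1) - M (p n).
  elim: n => [|n IH]; first by rewrite /p mul1r mul0r addr0 /D /d subrKC.
  have dp : d < p n.+1 by rewrite pS; have := xp n; lra.
  have := Mc (p n.+1) d d0 dp; rewrite -pS {2}pS addrK.
  by move: IH; lra.
have grow n : M x + n%:R * D <= M (p n).
  elim: n => [|n IH]; first by rewrite /p !mul0r !addr0.
  by have := step n; rewrite -natr1 mulrDl mul1r; lra.
have [n Hn] : exists n : nat, (K - M x) / D < n%:R.
  by exists (Num.truncn ((K - M x) / D)).+1; exact: truncnS_gt.
have := MK (p n) (lt_le_trans x0 (xp n)); have := grow n.
by move: Hn; rewrite ltr_pdivrMr//; lra.
Qed.

Section hardy_lines.
Context {R : realType}.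
Implicit Types (f g : R[i] -> R[i]) (x y : R).

(** [hardy] without the vanishing outside [Cplus], a normalization that [f \o affine a b] need not
    satisfy. *)
Definition in_hardy f := analytic_on (@Cplus R) f /\ (hardy_sup f < +oo)%E.

(** The real part of [z * w^*], that is, the inner product of the plane. The imaginary part of
    [hardy_dot] is reached later by multiplying one argument by ['i]. *)
Definition cdot (z w : R[i]) : R :=
  complex.Re z * complex.Re w + complex.Im z * complex.Im w.

Definition line_dot f g x1 x2 := \int[mu]_y cdot (f (x1 +i* y)) (g (x2 +i* y)).

Lemma cdotzz z : cdot z z = normc z ^+ 2.
Proof. by rewrite sqr_normc /cdot !expr2. Qed.

Lemma cdot_le z w : `|cdot z w| <= normc z ^+ 2 + normc w ^+ 2.
Proof.
rewrite !sqr_normc /cdot; case: z w => a b [c d] /=; rewrite ler_norml.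
have := sqr_ge0 (a - c); have := sqr_ge0 (b - d).
have := sqr_ge0 (a + c); have := sqr_ge0 (b + d).
by have := sqr_ge0 a; have := sqr_ge0 b; have := sqr_ge0 c; have := sqr_ge0 d; nra.
Qed.

Lemma analytic_line_continuous f x y : analytic_on (@Cplus R) f -> 0 < x ->
  {for y, continuous (fun y => complex.Re (f (x +i* y)))} /\
  {for y, continuous (fun y => complex.Im (f (x +i* y)))}.
Proof.
move=> fan x0; have [l /has_cderiv_partials[Hr Hi]] := derivable_has_cderiv (fan (x +i* y) x0).
by split; [move/has_partialsC/has_partials_continuous: Hr|
  move/has_partialsC/has_partials_continuous: Hi].
Qed.

Lemma cdot_line_continuous f g x1 x2 :
  analytic_on (@Cplus R) f -> analytic_on (@Cplus R) g -> 0 < x1 -> 0 < x2 ->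
  continuous (fun y => cdot (f (x1 +i* y)) (g (x2 +i* y))).
Proof.
move=> fan gan x10 x20 y.
have [fr fi] := analytic_line_continuous y fan x10.
have [gr gi] := analytic_line_continuous y gan x20.
by apply: cvgD; apply: cvgM.
Qed.

Lemma cdot_line_measurable f g x1 x2 :
  analytic_on (@Cplus R) f -> analytic_on (@Cplus R) g -> 0 < x1 -> 0 < x2 ->
  measurable_fun setT (fun y => cdot (f (x1 +i* y)) (g (x2 +i* y))).
Proof. by move=> *; apply: continuous_measurable_fun; exact: cdot_line_continuous. Qed.

Lemma sqr_line_measurable f x : analytic_on (@Cplus R) f -> 0 < x ->
  measurable_fun setT (fun y => normc (f (x +i* y)) ^+ 2).
Proof.
by move=> fan x0; under eq_fun do rewrite -cdotzz; exact: cdot_line_measurable.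
Qed.

Lemma line_mean_ge0 f x : (0 <= line_mean f x)%E.
Proof.
apply: mule_ge0; first by rewrite lee_fin invr_ge0 pi_ge0.
by apply: integral_ge0 => y _; rewrite lee_fin sqr_ge0.
Qed.

Lemma line_mean_le_hardy_sup f x : 0 < x -> (line_mean f x <= hardy_sup f)%E.
Proof. by move=> x0; apply: ereal_sup_ubound; exists x. Qed.

Lemma hardy_sup_ge0 f : (0 <= hardy_sup f)%E.
Proof. exact: le_trans (line_mean_ge0 f 1) (line_mean_le_hardy_sup _ ltr01). Qed.

Lemma in_hardy_fin f : in_hardy f -> hardy_sup f \is a fin_num.
Proof. by move=> [_ foo]; rewrite ge0_fin_numE ?hardy_sup_ge0. Qed.

Lemma line_meanK f x :
  (\int[mu]_y (normc (f (x +i* y)) ^+ 2)%:E = pi%:E * line_mean f x)%E.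
Proof.
by rewrite /line_mean muleA -EFinM divff ?mul1e// gt_eqF// pi_gt0.
Qed.

Lemma in_hardy_line_bound f : in_hardy f -> exists2 K : R, 0 <= K & forall x, 0 < x ->
  (\int[mu]_y (normc (f (x +i* y)) ^+ 2)%:E <= K%:E)%E.
Proof.
move=> hf; exists (pi * fine (hardy_sup f)).
  by rewrite mulr_ge0 ?pi_ge0// fine_ge0// hardy_sup_ge0.
move=> x x0; rewrite line_meanK EFinM fineK ?in_hardy_fin//.
by rewrite lee_pmul2l ?lte_fin ?pi_gt0// line_mean_le_hardy_sup.
Qed.

Lemma sqr_line_integrable f x : in_hardy f -> 0 < x ->
  mu.-integrable setT (EFin \o (fun y => normc (f (x +i* y)) ^+ 2)).
Proof.
move=> hf x0; have [K _ HK] := in_hardy_line_bound hf.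
apply/integrableP; split.
  by apply/measurable_EFinP; exact: (sqr_line_measurable (proj1 hf)).
apply: le_lt_trans (ltry K); apply: le_trans (HK _ x0).
by under eq_integral do rewrite /= ger0_norm ?sqr_ge0//.
Qed.

Lemma cdot_line_integrable f g x1 x2 : in_hardy f -> in_hardy g -> 0 < x1 -> 0 < x2 ->
  mu.-integrable setT (EFin \o (fun y => cdot (f (x1 +i* y)) (g (x2 +i* y)))).
Proof.
move=> hf hg x10 x20.
apply: (le_integrable measurableT _ _ (integrableD measurableT
  (sqr_line_integrable hf x10) (sqr_line_integrable hg x20))).
  by apply/measurable_EFinP; apply: cdot_line_measurable => //; [case: hf|case: hg].
move=> y _ /=; rewrite lee_fin; apply: (le_trans (cdot_le _ _)).
by rewrite ler_norm.
Qed.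

Lemma line_dotE f x : line_dot f f x x = \int[mu]_y (normc (f (x +i* y)) ^+ 2).
Proof. by rewrite /line_dot; under eq_Rintegral do rewrite cdotzz. Qed.

Lemma line_meanE f x : in_hardy f -> 0 < x ->
  line_mean f x = (pi^-1 * line_dot f f x x)%:E.
Proof.
move=> hf x0; rewrite line_dotE EFinM /Rintegral fineK//.
by apply: integrable_fin_num => //; exact: sqr_line_integrable.
Qed.

End hardy_lines.

(** * Pairings between two vertical lines, and the norm as a boundary limit *)

Section hardy_shift.
Context {R : realType}.
Implicit Types (f g : R[i] -> R[i]) (x y : R).

Lemma line_dot_shift f g x1 x2 t1 t2 : in_hardy f -> in_hardy g ->
  0 < x1 -> 0 < x2 -> 0 < t1 -> 0 < t2 -> x1 + x2 = t1 + t2 ->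
  line_dot f g x1 x2 = line_dot f g t1 t2.
Proof.
move=> hf hg.
(* The strip for the contour shift lies between [x1] and [t1], which therefore have to be
   ordered. *)
wlog x1t1 : x1 x2 t1 t2 / x1 <= t1.
  move=> H x10 x20 t10 t20 E; have [xt|tx] := leP x1 t1; first exact: H.
  by apply/esym/H => //; exact: ltW.
move=> x10 x20 t10 t20 E; pose s := x1 + x2.
pose F z := f z * (g (s%:C - z^*))^*.
have rE u v : s%:C - (u +i* v)^* = (s - u) +i* v.
  by apply/eqP; rewrite eq_complex/=; apply/andP; split; apply/eqP; ring.
have ReF u v : complex.Re (F (u +i* v)) = cdot (f (u +i* v)) (g ((s - u) +i* v)).
  rewrite /F rE /cdot; case: (f _) (g _) => a b [c d] /=; ring.
(* The imaginary part of [z * w^*] is the [cdot] of [z] with its coordinates swapped and of [w^*],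
   so [cdot_le] bounds it too. *)
have ImF u v : `|complex.Im (F (u +i* v))| <=
    normc (f (u +i* v)) ^+ 2 + normc (g ((s - u) +i* v)) ^+ 2.
  rewrite /F rE; case: (f _) (g _) => a b [c d].
  have := cdot_le (b +i* a) (c -i* d); rewrite !sqr_normc /cdot /= sqrrN [b ^+ 2 + _]addrC.
  by congr (`|_| <= _); ring.
have [Kf Kf0 HKf] := in_hardy_line_bound hf.
have [Kg Kg0 HKg] := in_hardy_line_bound hg.
have su u : x1 <= u <= t1 -> 0 < u /\ 0 < s - u by rewrite /s; lra.
have s1 : s - x1 = x2 by rewrite /s addrC addKr.
have s2 : s - t1 = t2 by rewrite /s E addrC addKr.
have EQ u : (fun v => complex.Re (F (u +i* v))) =
    (fun v => cdot (f (u +i* v)) (g ((s - u) +i* v))).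
  by apply/funext => v; exact: ReF.
have I1 : mu.-integrable setT (EFin \o (fun v => complex.Re (F (x1 +i* v)))).
  by rewrite EQ s1; exact: cdot_line_integrable.
have I2 : mu.-integrable setT (EFin \o (fun v => complex.Re (F (t1 +i* v)))).
  by rewrite EQ s2; exact: cdot_line_integrable.
rewrite /line_dot -{1}s1 -s2.
have -> : \int[mu]_v cdot (f (x1 +i* v)) (g ((s - x1) +i* v)) =
    \int[mu]_v complex.Re (F (x1 +i* v)) by rewrite /= EQ.
have -> : \int[mu]_v cdot (f (t1 +i* v)) (g ((s - t1) +i* v)) =
    \int[mu]_v complex.Re (F (t1 +i* v)) by rewrite /= EQ.
have dF u v : x1 <= u <= t1 -> exists l, has_cderiv F (u +i* v) l.
  move=> /su[u0 su0]; apply: derivable_has_cderiv; apply: derivableM.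
    by case: hf => + _; apply.
  by apply: derivable_conj_reflection; rewrite rE; case: hg => + _; apply.
(* The form [P dx + Q dy] is here the imaginary part of [F dz]; both [P_y] and [Q_x] equal the real
   part of the derivative of [F]. *)
apply: (@strip_shift R (fun u v => complex.Im (F (u +i* v)))
  (fun u v => complex.Re (F (u +i* v))) x1 t1 (Kf + Kg) x1t1) => //.
- move=> u v /(dF u v)[l /has_cderiv_partials[HR HI]].
  by exists (complex.Im l), (complex.Re l), (- complex.Im l).
- move=> u hu; have [u0 su0] := su _ hu.
  have mF := sqr_line_measurable (proj1 hf) u0.
  have mG := sqr_line_measurable (proj1 hg) su0.
  rewrite EFinD; apply: le_trans (leeD (HKf _ u0) (HKg _ su0)).
  rewrite -ge0_integralD//; try by [move=> *; rewrite lee_fin sqr_ge0|apply/measurable_EFinP].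
  apply: ge0_le_integral => //.
  - apply/measurable_EFinP; apply: measurableT_comp => //.
    apply: continuous_measurable_fun => v.
    have [l /has_cderiv_partials[_ /has_partialsC]] := dF u v hu.
    exact: has_partials_continuous.
  - by apply: emeasurable_funD; apply/measurable_EFinP.
  - by move=> v _; rewrite lee_fin ImF.
Qed.

Lemma line_dot_nonincreasing f x y : in_hardy f -> 0 < x -> x <= y ->
  line_dot f f y y <= line_dot f f x x.
Proof.
move=> hf; have [K K0 HK] := in_hardy_line_bound hf.
apply: (@midpoint_convex_bounded_nonincreasing _ (fun x => line_dot f f x x) K).
  move=> {}x x0; rewrite line_dotE -lee_fin /Rintegral fineK; first exact: HK.
  by apply: integrable_fin_num => //; exact: sqr_line_integrable.
move=> {x y}m d d0 dm.
have m1 : 0 < m - d by lra.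
have m2 : 0 < m + d by lra.
have m0 : 0 < m by lra.
(* The shift turns the pairing on the line [m] into one between the lines [m - d] and [m + d], where
   twice the product of two vectors is at most the sum of their squared lengths. *)
rewrite (@line_dot_shift f f m m (m - d) (m + d))//; last lra.
rewrite !line_dotE -RintegralD//; try exact: sqr_line_integrable.
rewrite /line_dot -RintegralZl//; last exact: cdot_line_integrable.
apply: le_Rintegral => //.
- exact: (integrableZl measurableT 2 (cdot_line_integrable hf hf m1 m2)).
- exact: (integrableD measurableT (sqr_line_integrable hf m1) (sqr_line_integrable hf m2)).
move=> v _; rewrite !sqr_normc /cdot.
case: (f _) (f _) => a b [a' b'] /=.
by have := sqr_ge0 (a - a'); have := sqr_ge0 (b - b'); nra.
Qed.

Lemma cvg_line_dot f : in_hardy f ->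
  pi^-1 * line_dot f f x x @[x --> 0^'+] --> hardy_norm f ^+ 2.
Proof.
move=> hf; rewrite /hardy_norm sqr_sqrtr ?fine_ge0 ?hardy_sup_ge0//.
have supE : hardy_sup f = ereal_sup (line_mean f @` [set` `]0, +oo[]).
  congr ereal_sup; apply: eq_set => r; apply/propeqP; split.
    by move=> [x /= x0 <-]; exists x => //=; rewrite in_itv/= x0.
  by move=> [x /=]; rewrite in_itv/= andbT => x0 <-; exists x.
have H : line_mean f x @[x --> 0^'+] --> hardy_sup f.
  rewrite supE; apply: (@nonincreasing_at_right_cvge _ (line_mean f) 0 (BInfty _ false)).
    by rewrite bnd_simp.
  move=> x y; rewrite !in_itv/= !andbT => x0 y0 xy.
  rewrite !line_meanE// lee_fin ler_pM2l ?invr_gt0 ?pi_gt0//.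
  exact: line_dot_nonincreasing.
have {}H : fine (line_mean f x) @[x --> 0^'+] --> fine (hardy_sup f).
  by apply: fine_cvg; rewrite fineK ?in_hardy_fin.
apply: cvg_trans H; apply: near_eq_cvg; near=> x.
by rewrite line_meanE//; near: x; exact: nbhs_right_gt.
Unshelve. all: by end_near. Qed.

End hardy_shift.

(** * Linear combinations and affine substitutions in the Hardy space *)

Section hardy_closure.
Context {R : realType}.
Implicit Types (f g : R[i] -> R[i]) (c : R[i]).

Lemma sqr_normcM c z : normc (c * z) ^+ 2 = normc c ^+ 2 * normc z ^+ 2 :> R.
Proof. by rewrite !sqr_normc; case: c z => a b [u v] /=; ring. Qed.

Lemma hardy_in f : hardy f -> in_hardy f.
Proof. by case. Qed.

Lemma H2_in (f : H2 R) : in_hardy f.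
Proof. exact: hardy_in (set_valP f). Qed.

Lemma in_hardy_comb c f g :
  in_hardy f -> in_hardy g -> in_hardy (fun z => f z + c * g z).
Proof.
move=> hf hg.
have fan : analytic_on (@Cplus R) (fun z => f z + c * g z).
  move=> z zC; apply: derivableD; first exact: (proj1 hf).
  by apply: derivableM; [exact: derivable_cst|exact: (proj1 hg)].
split=> //.
have [Kf Kf0 HKf] := in_hardy_line_bound hf.
have [Kg Kg0 HKg] := in_hardy_line_bound hg.
(* The constant comes from the pointwise bound of [|f + c g|^2] by [2 |f|^2 + 2 |c|^2 |g|^2]. *)
apply: (@le_lt_trans _ _ (pi^-1 * (2 * Kf + 2 * normc c ^+ 2 * Kg))%:E); last exact: ltry.
apply: ge_ereal_sup => _ [x /= x0 <-].
rewrite /line_mean EFinM lee_pmul2l ?lte_fin ?invr_gt0 ?pi_gt0//.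
have c0 : 0 <= 2 * normc c ^+ 2 by rewrite mulr_ge0 ?sqr_ge0.
rewrite EFinD EFinM [X in (_ <= _ + X)%E]EFinM.
apply: (@le_trans _ _ (2%:E * \int[mu]_y (normc (f (x +i* y)) ^+ 2)%:E +
    (2 * normc c ^+ 2)%:E * \int[mu]_y (normc (g (x +i* y)) ^+ 2)%:E)%E); last first.
  by apply: leeD; apply: lee_wpmul2l; rewrite ?lee_fin//; [exact: HKf|exact: HKg].
have mf := sqr_line_measurable (proj1 hf) x0.
have mg := sqr_line_measurable (proj1 hg) x0.
rewrite -!ge0_integralZl_EFin//; try by [move=> *; rewrite lee_fin sqr_ge0|apply/measurable_EFinP].
rewrite -ge0_integralD//;
  try by [move=> *; rewrite -EFinM lee_fin mulr_ge0 ?sqr_ge0|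
    apply: measurable_funeM; apply/measurable_EFinP].
apply: ge0_le_integral => //.
- by move=> y _; rewrite lee_fin sqr_ge0.
- by apply/measurable_EFinP; exact: (sqr_line_measurable fan x0).
- by apply: emeasurable_funD; apply: measurable_funeM; apply/measurable_EFinP.
move=> y _; rewrite -!EFinM -EFinD lee_fin -mulrA -sqr_normcM.
rewrite !sqr_normc; case: (f _) (c * _) => a b [u v] /=.
by have := sqr_ge0 (a - u); have := sqr_ge0 (b - v); nra.
Qed.

Lemma integral_affine (G : R -> R) (a t : R) : 0 < a -> continuous G ->
  (forall y, 0 <= G y) ->
  (\int[mu]_y (G (a * y + t))%:E = a^-1%:E * \int[mu]_y (G y)%:E)%E.
Proof.
move=> a0 cG G0.
have D1 (y : R) : is_derive y 1 (fun y => a * y + t) a.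
  by apply: is_derive_eq; rewrite /GRing.scale/= ?mulr1 ?mulr0 ?addr0 ?add0r.
have dE : (fun y : R => a * y + t)^`()%classic = cst a.
  by apply/funext => y; rewrite derive1E derive_val.
have cF : continuous (fun y : R => a * y + t).
  by move=> y; apply: cvgD; [apply: cvgMr; exact: cvg_id|exact: cvg_cst].
rewrite (increasing_ge0_integration_by_substitutionT (F := fun y => a * y + t) (G := G))//.
- rewrite dE -ge0_integralZl_EFin//.
  + apply: eq_integral => y _; rewrite -EFinM; congr EFin.
    by rewrite !fctE/= [RHS]mulrC mulfK// gt_eqF.
  + by move=> y _; rewrite lee_fin !fctE mulr_ge0 ?(ltW a0)/=.
  + apply/measurable_EFinP; apply: continuous_measurable_fun => y.
    apply: cvgM; last exact: cvg_cst.
    by apply: (@continuous_comp _ _ _ (fun y => a * y + t) G); [exact: cF|exact: cG].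
  + by rewrite invr_ge0 ltW.
- by move=> y z yz; rewrite ltrD2r ltr_pM2l.
- by rewrite dE; exact: cst_continuous.
- by rewrite dE; exact: is_cvg_cst.
- by rewrite dE; exact: is_cvg_cst.
- apply/cvgrNyPle => A; near=> y.
  rewrite -lerBrDr -ler_pdivlMl//; near: y; exact: nbhs_ninfty_le.
- apply/cvgryPge => A; near=> y.
  rewrite -lerBlDr -ler_pdivrMl//; near: y; exact: nbhs_pinfty_ge.
Unshelve. all: by end_near. Qed.

Lemma affineE (a : R) (b : R[i]) x y :
  affine a b (x +i* y) = (a * x + complex.Re b) +i* (a * y + complex.Im b).
Proof. by rewrite /affine; case: b => u v; simpc. Qed.

Lemma line_mean_affine f (a : R) (b : R[i]) x : analytic_on (@Cplus R) f ->
  0 < a -> 0 < a * x + complex.Re b ->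
  line_mean (f \o affine a b) x = (a^-1%:E * line_mean f (a * x + complex.Re b))%E.
Proof.
move=> fan a0 X0; rewrite /line_mean muleCA; congr (_ * _)%E.
under eq_integral do rewrite /= affineE.
rewrite (integral_affine (G := fun y => normc (f ((a * x + complex.Re b) +i* y)) ^+ 2))//.
  by under eq_fun do rewrite -cdotzz; exact: cdot_line_continuous.
by move=> y; exact: sqr_ge0.
Qed.

Lemma eq_line_mean f g x : 0 < x -> (forall z, Cplus z -> f z = g z) ->
  line_mean f x = line_mean g x.
Proof. by move=> x0 fg; rewrite /line_mean; under eq_integral do rewrite fg//. Qed.

Lemma in_hardy_affine f (a : R) (b : R[i]) : in_hardy f -> 0 < a -> 0 <= complex.Re b ->
  in_hardy (f \o affine a b).
Proof.
move=> hf a0 b0.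
have X0 x : 0 < x -> 0 < a * x + complex.Re b by move=> x0; rewrite ltr_wpDr// mulr_gt0.
split.
  move=> [x y] xC.
  change (@derivable _ R[i]^o R[i]^o ((f : R[i]^o -> R[i]^o) \o affine a b) (x +i* y) 1).
  apply/derivable1_diffP/differentiable_comp.
    apply/derivable1_diffP; apply: derivableD; last exact: derivable_cst.
    by apply: derivableM; [exact: derivable_cst|exact: derivable_id].
  by apply/derivable1_diffP; apply: (proj1 hf); rewrite affineE /Cplus/=; exact: X0.
apply: (@le_lt_trans _ _ (a^-1%:E * hardy_sup f)%E); last first.
  by rewrite -(fineK (in_hardy_fin hf)) -EFinM ltry.
apply: ge_ereal_sup => _ [x /= x0 <-]; rewrite line_mean_affine//; [|exact: (proj1 hf)|exact: X0].
by rewrite lee_pmul2l ?lte_fin ?invr_gt0// line_mean_le_hardy_sup// X0.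
Qed.

(** With a purely imaginary translation, the affine map permutes the vertical lines of [Cplus], so
    equality holds: the line at [x] is the image of the line at [a^-1 * x]. *)
Lemma hardy_sup_rescale f (a t : R) : analytic_on (@Cplus R) f -> 0 < a ->
  hardy_sup (f \o affine a (0 +i* t)) = (a^-1%:E * hardy_sup f)%E.
Proof.
move=> fan a0; have aV0 : 0 < a^-1 by rewrite invr_gt0.
apply/eqP; rewrite eq_le; apply/andP; split.
  apply: ge_ereal_sup => _ [x /= x0 <-]; rewrite line_mean_affine//= ?addr0 ?mulr_gt0//.
  by rewrite lee_pmul2l ?lte_fin// line_mean_le_hardy_sup// mulr_gt0.
rewrite -lee_pdivlMl ?lte_fin// ?invr_gt0// invrK.
apply: ge_ereal_sup => _ [x /= x0 <-].
have := @line_mean_affine f a (0 +i* t) (a^-1 * x) fan a0.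
rewrite /= addr0 mulrA divff ?gt_eqF// mul1r => /(_ x0) E.
rewrite -lee_pdivrMl//.
rewrite -E; apply: line_mean_le_hardy_sup; exact: mulr_gt0.
Qed.

End hardy_closure.

(** * The adjoint *)

Section adjoint.
Context {R : realType}.
Implicit Types (f g : R[i] -> R[i]) (c : R[i]).

Definition comb_norm2 f g c : R := hardy_norm (fun z => f z + c * g z) ^+ 2.

(** By [cvg_polar] below, this is four times the real part of the inner product of [f] and [c g],
    for [f] and [g] in the Hardy space. *)
Definition polar f g c : R := comb_norm2 f g c - comb_norm2 f g (- c).

(** The terms [k] and [k + 2] of the polarization sum have opposite coefficients and combine into
    one [polar]. *)
Lemma hardy_dotE f g :
  hardy_dot f g = (polar f g 1 / 4) +i* (polar f g 'i%C / 4).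
Proof.
rewrite /polar; set N := comb_norm2 f g.
have -> : hardy_dot f g = 4^-1 * \sum_(k < 4) 'i%C ^+ k * (N ('i%C ^+ k))%:C by [].
rewrite -(big_mkord xpredT (fun k => 'i%C ^+ k * (N ('i%C ^+ k))%:C)).
rewrite /index_iota/= !big_cons big_nil.
have i2 : 'i%C ^+ 2 = -1 :> R[i] by exact: sqr_i.
have i3 : 'i%C ^+ 3 = - 'i%C :> R[i] by rewrite exprS i2 mulrN1.
rewrite expr0 expr1 i2 i3.
move: (N _) (N _) (N _) (N _) => x y z t.
rewrite (_ : 4^-1 = (4^-1)%:C :> R[i]); last by rewrite fmorphV/= rmorph_nat.
simpc.
by apply/eqP; rewrite eq_complex /=; apply/andP; split; apply/eqP; field.
Qed.

(** Both squared norms are limits of line integrals, and pointwise [|u + v|^2 - |u - v|^2] is four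
    times the [cdot] of [u] and [v]. *)
Lemma cvg_polar f g c : in_hardy f -> in_hardy g ->
  pi^-1 * (4 * line_dot f (fun z => c * g z) x x) @[x --> 0^'+] --> polar f g c.
Proof.
move=> hf hg.
have hp := in_hardy_comb c hf hg; have hm := in_hardy_comb (- c) hf hg.
pose L (h : R[i] -> R[i]) (x : R) : R := pi^-1 * line_dot h h x x.
have H : L (fun z => f z + c * g z) x - L (fun z => f z + (- c) * g z) x
    @[x --> 0^'+] --> polar f g c.
  exact: (cvgB (cvg_line_dot hp) (cvg_line_dot hm)).
apply: cvg_trans H; apply: near_eq_cvg; near=> x.
have x0 : 0 < x by near: x; exact: nbhs_right_gt.
rewrite /L -mulrBr; congr (_ * _).
rewrite /line_dot -RintegralB//; last 2 first.
- exact: (cdot_line_integrable hp hp x0 x0).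
- exact: (cdot_line_integrable hm hm x0 x0).
have hcg : in_hardy (fun z => c * g z).
  have := in_hardy_comb c (hardy_in (@hardy0 R)) hg.
  by under eq_fun do rewrite add0r.
rewrite -RintegralZl//; last exact: (cdot_line_integrable hf hcg).
apply: eq_Rintegral => y _; rewrite /cdot mulNr.
by case: (f _) (c * _) => a b [u v] /=; ring.
Unshelve. all: by end_near. Qed.

Lemma polarC f g : in_hardy f -> in_hardy g -> polar f g 1 = polar g f 1.
Proof.
move=> hf hg; rewrite -(cvg_lim (@Rhausdorff R) (cvg_polar (c := 1) hf hg)).
apply: cvg_lim => //.
have -> : (fun x => pi^-1 * (4 * line_dot f (fun z => 1 * g z) x x)) =
    (fun x => pi^-1 * (4 * line_dot g (fun z => 1 * f z) x x)).
  apply/funext => x; rewrite /line_dot; congr (_ * (_ * _)).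
  by apply: eq_Rintegral => y _; rewrite /cdot !mul1r mulrC [X in _ + X]mulrC.
exact: cvg_polar.
Qed.

Lemma polar_self f : in_hardy f -> polar f f 1 = 4 * hardy_norm f ^+ 2.
Proof.
move=> hf; rewrite -(cvg_lim (@Rhausdorff R) (cvg_polar (c := 1) hf hf)).
apply: cvg_lim => //.
have -> : (fun x => pi^-1 * (4 * line_dot f (fun z => 1 * f z) x x)) =
    (fun x => 4 * (pi^-1 * line_dot f f x x)).
  by apply/funext => x; under [fun z => 1 * f z]eq_fun do rewrite mul1r; ring.
by apply: cvgMr; exact: cvg_line_dot.
Qed.

(* Testing on [f = h1] and on [f = h2] identifies both squared norms with the real
   part of [hardy_dot h1 h2]; no additivity of [hardy_dot] is needed. *)
Lemma hardy_norm_unique (h1 h2 : H2 R) :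
  (forall f : H2 R, hardy_dot f h1 = hardy_dot f h2) -> hardy_norm h1 = hardy_norm h2.
Proof.
move=> H.
have P (f : H2 R) : polar f h1 1 = polar f h2 1.
  have E := etrans (esym (hardy_dotE f h1)) (etrans (H f) (hardy_dotE f h2)).
  by apply: mulIf (congr1 (@complex.Re R) E); rewrite invr_eq0 pnatr_eq0.
have E : 4 * hardy_norm h1 ^+ 2 = 4 * hardy_norm h2 ^+ 2.
  rewrite -(polar_self (H2_in h1)) -(polar_self (H2_in h2)).
  by rewrite P (polarC (H2_in h1) (H2_in h2)) P.
have {}E : hardy_norm h1 ^+ 2 = hardy_norm h2 ^+ 2.
  by apply: mulfI E; rewrite pnatr_eq0.
by apply: (pexpIrn (n := 2)) E => //; exact: sqrtr_ge0.
Qed.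

Variables (a : R) (b : R[i]) (a0 : 0 < a) (b0 : 0 < complex.Re b).

Let aV0 : 0 < a^-1. Proof. by rewrite invr_gt0. Qed.

Let b' : R[i] := a^-1%:C * b^*.

Let Re_b' : complex.Re b' = a^-1 * complex.Re b.
Proof. by rewrite /b'; case: b => u v; simpc. Qed.

Let b'0 : 0 <= complex.Re b'.
Proof. by rewrite Re_b' mulr_ge0// ltW. Qed.

Lemma hardy_affine_adjoint (g : H2 R) :
  hardy (fun z => a^-1%:C * comp_fun (affine a^-1 (a^-1%:C * b^*)) g z).
Proof.
have [han hsup h0] := hardy_affine aV0 b'0 g.
split.
- by move=> z zC; apply: derivableM; [exact: derivable_cst|exact: han].
- have [_] := in_hardy_comb a^-1%:C (hardy_in (@hardy0 R)) (conj han hsup).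
  by under eq_fun do rewrite add0r.
- by move=> z zC; rewrite h0 ?mulr0.
Qed.

Definition affine_adjoint (g : H2 R) : H2 R := toH2 (hardy_affine_adjoint g).

(* With [t z = a z + i Im b] and [r = Re b / a], [C_phi f] is [f \o t] translated
   by [r] and [affine_adjoint g \o t] is [a^-1 g] translated by [r]; contour
   shifting moves the translation from one factor to the other. *)
Lemma polar_adjoint (f g : H2 R) c :
  polar (comp_fun (affine a b) f) g c = polar f (affine_adjoint g) c.
Proof.
have hf := H2_in f; have hg := H2_in g; have hS := H2_in (affine_adjoint g).
have hC := hardy_in (hardy_affine a0 (ltW b0) f).
pose r := complex.Re b / a; pose t := affine a (0 +i* complex.Im b).
have r0 : 0 < r by rewrite divr_gt0.
have hft : in_hardy (f \o t) by apply: in_hardy_affine.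
have hSt : in_hardy (affine_adjoint g \o t) by apply: in_hardy_affine.
have hcg : in_hardy (fun z => c * g z).
  have := in_hardy_comb c (hardy_in (@hardy0 R)) hg.
  by under eq_fun do rewrite add0r.
(* Composition with [t] divides every squared norm by [a], so [polar] can be computed after
   composing both arguments with [t]. *)
have norm_t h : in_hardy h -> hardy_norm h ^+ 2 = a * hardy_norm (h \o t) ^+ 2.
  move=> hh; rewrite /hardy_norm !sqr_sqrtr ?fine_ge0 ?hardy_sup_ge0//.
  rewrite hardy_sup_rescale//; last exact: (proj1 hh).
  by rewrite -(fineK (in_hardy_fin hh)) -EFinM /= mulrA divff ?mul1r// gt_eqF.
have -> : polar f (affine_adjoint g) c = a * polar (f \o t) (affine_adjoint g \o t) c.
  have E c' : comb_norm2 f (affine_adjoint g) c' =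
      a * comb_norm2 (f \o t) (affine_adjoint g \o t) c'.
    exact: norm_t (in_hardy_comb c' hf hS).
  by rewrite /polar !E mulrBr.
rewrite -(cvg_lim (@Rhausdorff R) (cvg_polar (c := c) hC hg)); apply: cvg_lim => //.
have H : a * (pi^-1 * (4 * line_dot (f \o t) (fun z => c * (affine_adjoint g \o t) z) x x))
    @[x --> 0^'+] --> a * polar (f \o t) (affine_adjoint g \o t) c.
  by apply: cvgMr; exact: cvg_polar.
apply: cvg_trans H.
apply: near_eq_cvg; near=> x.
have x0 : 0 < x by near: x; exact: nbhs_right_gt.
have tE u v : t (u +i* v) = (a * u) +i* (a * v + complex.Im b) by rewrite /t affineE addr0.
have -> : line_dot (f \o t) (fun z => c * (affine_adjoint g \o t) z) x x =
    a^-1 * line_dot (f \o t) (fun z => c * g z) x (x + r).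
  rewrite /line_dot -RintegralZl//; last exact: (cdot_line_integrable hft hcg x0 (addr_gt0 x0 r0)).
  apply: eq_Rintegral => y _; rewrite /= tE.
  have -> : affine_adjoint g ((a * x) +i* (a * y + complex.Im b)) =
      a^-1%:C * g ((x + r) +i* y).
    rewrite /H2_fun/= /comp_fun/= mulr_gt0// affineE; congr (_ * g _).
    rewrite Re_b'; apply/eqP; rewrite eq_complex/=; apply/andP; split; apply/eqP.
      by rewrite /r; field; rewrite gt_eqF.
    by case: b => u v /=; field; rewrite gt_eqF.
  rewrite /cdot mulrCA; case: (f _) (c * _) => u v [u' v'] /=; ring.
have -> : line_dot (comp_fun (affine a b) f) (fun z => c * g z) x x =
    line_dot (f \o t) (fun z => c * g z) (x + r) x.
  rewrite /line_dot; apply: eq_Rintegral => y _; rewrite /comp_fun/= x0 tE affineE.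
  by rewrite /r mulrDr mulrC [a * (_ / a)]mulrC divfK// gt_eqF.
rewrite (@line_dot_shift _ _ _ (x + r) x x (x + r))//; [|exact: addr_gt0..|exact: addrC].
by move: pi^-1 (line_dot _ _ _ _) => p X; field; rewrite gt_eqF.
Unshelve. all: by end_near. Qed.

Let C_phi := composition_operator _ (affine_bounded_composition a0 (ltW b0)).

(** [affine_adjoint] witnesses that the set in the definition of [adjoint] is nonempty, so the
    chosen map satisfies the adjoint relation as well; that relation determines the norm of the
    image by [hardy_norm_unique]. *)
Lemma hardy_norm_adjoint (g : H2 R) :
  hardy_norm (adjoint C_phi g) = hardy_norm (affine_adjoint g).
Proof.
have adjP : [set S : H2 R -> H2 R |
    forall f g : H2 R, hardy_dot (C_phi f) g = hardy_dot f (S g)] (adjoint C_phi).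
  apply: getPex; exists affine_adjoint => f {}g.
  by rewrite !hardy_dotE /= !(polar_adjoint f g).
apply: hardy_norm_unique => f; rewrite -adjP !hardy_dotE /=.
by rewrite !(polar_adjoint f g).
Qed.

Lemma line_mean_composition (f : H2 R) x : 0 < x ->
  line_mean (comp_fun (affine a b) f) x = (a^-1%:E * line_mean f (a * x + complex.Re b))%E.
Proof.
move=> x0; rewrite -line_mean_affine//; [|by case: (H2_in f)|].
  by apply: eq_line_mean => // z zC; rewrite /comp_fun zC.
by rewrite addr_gt0// mulr_gt0.
Qed.

Lemma line_mean_adjoint (f : H2 R) x : 0 < x ->
  line_mean (affine_adjoint f) x = (a^-1%:E * line_mean f (a^-1 * (x + complex.Re b)))%E.
Proof.
move=> x0; rewrite mulrDr -Re_b'.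
have X0 : 0 < a^-1 * x + complex.Re b' by rewrite ltr_wpDr// mulr_gt0.
have fan := proj1 (H2_in f).
(* The coefficient [a^-1] enters squared, and the substitution with slope [a^-1] contributes a
   factor [a], which leaves a single [a^-1]. *)
have -> : line_mean f (a^-1 * x + complex.Re b') =
    (a^-1%:E * line_mean (f \o affine a^-1 b') x)%E.
  rewrite line_mean_affine// muleA -EFinM divff ?mul1e//.
  by rewrite gt_eqF.
rewrite muleA -EFinM /line_mean muleCA; congr (_ * _)%E.
rewrite -ge0_integralZl_EFin//.
- apply: eq_integral => y _; rewrite -EFinM; congr EFin.
  rewrite /H2_fun/= /comp_fun/= x0 sqr_normcM; congr (_ * _).
  by rewrite sqr_normc/= expr0n addr0.
- by move=> y _; rewrite lee_fin sqr_ge0.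
- apply/measurable_EFinP.
  exact: (sqr_line_measurable (proj1 (in_hardy_affine (H2_in f) aV0 b'0)) x0).
- by rewrite mulr_ge0// ltW.
Qed.

End adjoint.

(** * The test function [1 / (z + 1)], whose line means are explicit *)

Section witness.
Context {R : realType}.

Definition shifted_inv (z : R[i]) : R[i] := if 0 < complex.Re z then (z + 1)^-1 else 0.

Lemma line_mean_shifted_inv (x : R) : 0 < x ->
  line_mean shifted_inv x = (x + 1)^-1%:E.
Proof.
move=> x0; have x10 : 0 < x + 1 by rewrite addr_gt0.
(* Rescaling [y] by [x + 1] reduces the integral to that of [1 / (1 + y^2)], which by evenness is
   twice its value on the half-line. *)
pose G (y : R) := ((x + 1) ^+ 2)^-1 * (oneDsqr y)^-1.
have GE (y : R) : normc (shifted_inv (x +i* y)) ^+ 2 = G ((x + 1)^-1 * y + 0).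
  rewrite /shifted_inv /= x0 sqr_normc /G /oneDsqr /=.
  by field; rewrite !gt_eqF//= ltr_pwDl ?exprn_gt0 ?sqr_ge0//; nra.
rewrite /line_mean; under eq_integral do rewrite GE.
have G0 y : 0 <= G y by rewrite /G mulr_ge0// ?invr_ge0 ?sqr_ge0// (le_trans ler01 (oneDsqr_ge1 _)).
rewrite (integral_affine _ _ _ G0) ?invr_gt0//; last first.
  by move=> y; apply: cvgMr; exact: continuous_oneDsqrV.
rewrite invrK ge0_symfun_integralT//; last first.
- by move=> y; rewrite /G /oneDsqr /= sqrrN.
- by move=> y; apply: cvgMr; exact: continuous_oneDsqrV.
rewrite -set_itvcy.
under eq_integral do rewrite EFinM.
rewrite ge0_integralZl_EFin//; last 2 first.
- apply/measurable_EFinP; apply: measurable_funTS; apply: continuous_measurable_fun.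
  exact: continuous_oneDsqrV.
- by rewrite invr_ge0 sqr_ge0.
rewrite integral0y_oneDsqr -!EFinM; congr EFin.
have := pi_gt0 R; move: pi => p p0.
by field; rewrite !gt_eqF.
Qed.

Lemma shifted_inv_hardy : hardy shifted_inv.
Proof.
split.
- move=> z zC; have z10 : z + 1 != 0.
    apply/eqP => /(congr1 (@complex.Re R)); rewrite raddfD/= => E.
    by move: zC; rewrite /Cplus/=; lra.
  apply: (@near_eq_derivable _ R[i]^o R[i]^o ((fun w => (w + 1)^-1) : R[i]^o -> R[i]^o)).
    have nC : \forall w \near (z : R[i]^o), 0 < complex.Re w.
      apply/(@nbhs_normP _ R[i]^o); exists (complex.Re z)%:C; first by rewrite /= ltcR.
      move=> w; rewrite /ball_/= normcE ltcR => zw.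
      have := ler_Re_normc (z - w); rewrite raddfB/= ler_norml; lra.
    by apply: filterS nC => w w0; rewrite /shifted_inv w0.
  apply: derivableV => //.
- apply: (@le_lt_trans _ _ 1%:E); last exact: ltry.
  apply: ge_ereal_sup => _ [x /= x0 <-]; rewrite line_mean_shifted_inv// lee_fin.
  by rewrite invf_le1 ?addr_gt0// lerDr ltW.
- by move=> z; rewrite /shifted_inv /Cplus/=; case: ifP.
Qed.

Lemma hardy_norm_le (f g : R[i] -> R[i]) : in_hardy f -> in_hardy g ->
  (hardy_norm f <= hardy_norm g) = (hardy_sup f <= hardy_sup g)%E.
Proof.
move=> hf hg; rewrite /hardy_norm ler_sqrt ?fine_ge0 ?hardy_sup_ge0//.
by rewrite -lee_fin !fineK ?in_hardy_fin.
Qed.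

End witness.

Theorem theorem3p1 (R : realType) (a : R) (b : R[i])
  (a_gt0 : 0 < a) (b_gt0 : 0 < complex.Re b) :
  let phi := affine a b in
  let C_phi := composition_operator phi
                 (affine_bounded_composition a_gt0 (ltW b_gt0)) in
  (a < 1 -> ~ cohyponormal C_phi) /\ (1 < a -> cohyponormal C_phi).
Proof.
move=> phi C_phi; pose B := complex.Re b; have B0 : 0 < B by [].
have aV0 : 0 < a^-1 by rewrite invr_gt0.
have norm_le (f : H2 R) : (hardy_norm (C_phi f) <= hardy_norm (adjoint C_phi f)) =
    (hardy_sup (comp_fun phi f) <= hardy_sup (affine_adjoint a_gt0 b_gt0 f))%E.
  by rewrite hardy_norm_adjoint hardy_norm_le//; exact: H2_in.
split=> [a1 /(_ (toH2 shifted_inv_hardy))|a1 f]; rewrite norm_le; last first.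
  apply: ge_ereal_sup => _ [x /= x0 <-]; rewrite line_mean_composition// -/B.
  (* Solving [a^-1 * (y + B) = a * x + B] for [y] gives the line on which the adjoint sees the same
     mean of [f]. *)
  have y0 : 0 < a * (a * x + B) - B by nra.
  apply: le_trans (line_mean_le_hardy_sup _ y0).
  by rewrite line_mean_adjoint// -/B subrK mulKf// gt_eqF.
(* With this choice [a * x + B] is the midpoint of [B] and [a^-1 * B], strictly to the left of all
   lines that the adjoint sees. *)
pose x := (a^-1 * B - B) / (2 * a).
have aB : B < a^-1 * B by rewrite ltr_pMl// invf_gt1.
have x0 : 0 < x by rewrite divr_gt0 ?subr_gt0// mulr_gt0.
move=> /(le_trans (line_mean_le_hardy_sup _ x0)).
rewrite line_mean_composition// -/B line_mean_shifted_inv; last by rewrite addr_gt0// mulr_gt0.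
apply/negP; rewrite -ltNge.
(* The middle term is the value that the decreasing means give at the limiting line [a^-1 * B]; it
   bounds the supremum for the adjoint. *)
apply: (@le_lt_trans _ _ (a^-1%:E * ((a^-1 * B) + 1)^-1%:E)%E).
  apply: ge_ereal_sup => _ [y /= y0 <-]; rewrite line_mean_adjoint// -/B.
  rewrite lee_pmul2l ?lte_fin// line_mean_shifted_inv ?mulr_gt0 ?addr_gt0//.
  rewrite lee_fin lef_pV2 ?posrE ?addr_gt0 ?mulr_gt0 ?addr_gt0//.
  by rewrite lerD2r ler_pM2l// lerDr ltW.
have ax : a * x = (a^-1 * B - B) / 2 by rewrite /x; field; rewrite gt_eqF.
rewrite -!EFinM lte_fin ltr_pM2l// ltf_pV2 ?posrE ?ax; lra.
Qed.
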